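(* Let $A$ and $B$ be countable groups, let $B\curvearrowright I$ be an action of $B$ on a set $I$, and let $G\in\mathcal{WR}(A,B\curvearrowright I)$ be a (countable) wreath-like product group. Assume that $A$ is amenable, that $B$ is bi-exact, and that the action $B\curvearrowright I$ has amenable stabilizers. Then $G$ is bi-exact.
   Context: All groups are countable and discrete. Wreath-like products: given countable groups $A,B$ and an action $B\curvearrowright I$, $\mathcal{WR}(A,B\curvearrowright I)$ denotes the collection of all groups $G$ for which there is a short exact sequence $1\to A^{(I)}\to G\xrightarrow{\varepsilon}B\to1$, where $A^{(I)}=\bigoplus_{i\in I}A_i$ is the direct sum of copies $A_i$ of $A$ (identified with its image in $G$), such that $gA_ig^{-1}=A_{\varepsilon(g)i}$ for all $g\in G$, $i\in I$. The action $B\curvearrowright I$ has amenable stabilizers if for every $i\in I$ the subgroup $\{b\in B: bi=i\}$ is amenable. Bi-exactness: for a countable discrete group $G$, $\operatorname{Prob}(G)\subset\ell^1(G)$ is the set of probability measures on $G$, with left translation action $(k\cdot\mu)(g)=\mu(k^{-1}g)$. $G$ is bi-exact if it is exact and there is a map $\mu:G\to\operatorname{Prob}(G)$ such that $\lim_{g\to\infty}\|\mu(kgh)-k\cdot\mu(g)\|_1=0$ for all $h,k\in G$, where $g\to\infty$ means that $g$ eventually leaves every finite subset of $G$. *)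

(* Defs.v *)
From HB Require Import structures.
From mathcomp Require Import all_boot all_order all_algebra.
From mathcomp Require Import all_classical all_reals all_analysis.
Import numFieldNormedType.Exports.

Set Implicit Arguments.
Unset Strict Implicit.
Unset Printing Implicit Defensive.

Import Order.TTheory GRing.Theory Num.Theory.

Local Open Scope classical_set_scope.
Local Open Scope ring_scope.

(* [groupType] (mathcomp.boot.monoid) is the structure of arbitrary, possibly
   infinite, groups. *)

Record left_action (G : groupType) (X : Type) := LeftAction {
  lact :> G -> X -> X;
  lact1 : forall x, lact 1%g x = x;
  lactM : forall g h x, lact (g * h)%g x = lact g (lact h x)
}.

Section Stabilizer.
Variables (G : groupType) (X : Type) (act : left_action G X) (x : X).

Definition stab : pred G := fun g => `[< act g x = x >].

Definition stabilizer := {g : G | stab g}.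

HB.instance Definition _ := [isSub of stabilizer for @sval G stab].
HB.instance Definition _ := [Choice of stabilizer by <:].

Lemma stab_group_closed : group_closed stab.
Proof.
split; first by apply/asboolP; exact: lact1.
move=> g h /asboolP gx /asboolP hx; apply/asboolP.
by rewrite lactM -[X in act h^-1%g X]hx -(lactM act h^-1%g) mulVg lact1.
Qed.

HB.instance Definition _ :=
  SubChoice_isSubGroup.Build G stab stabilizer stab_group_closed.

End Stabilizer.

Section DirectSum.
Variables (I : Type) (A : groupType).

Definition finsupp_pred : pred (I -> A) :=
  fun f => `[< finite_set [set i | f i <> 1%g] >].

Definition direct_sum := {f : I -> A | finsupp_pred f}.

HB.instance Definition _ :=
  [isSub of direct_sum for @sval (I -> A) finsupp_pred].
HB.instance Definition _ := [Choice of direct_sum by <:].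

Lemma dsum_one_subproof : finsupp_pred (fun=> 1%g).
Proof.
apply/asboolP; rewrite (_ : [set _ | _] = set0) //.
by apply/seteqP; split => i //=; apply.
Qed.

Lemma dsum_inv_subproof (f : direct_sum) :
  finsupp_pred (fun i => (val f i)^-1)%g.
Proof.
apply/asboolP; case: f => f /= /asboolP; apply: sub_finite_set => i /= + fi.
by rewrite fi invg1.
Qed.

Lemma dsum_mul_subproof (f g : direct_sum) :
  finsupp_pred (fun i => val f i * val g i)%g.
Proof.
apply/asboolP; case: f g => f /= /asboolP Ff [g /= /asboolP Fg].
have: finite_set ([set i | f i <> 1%g] `|` [set i | g i <> 1%g]).
  by rewrite finite_setU.
apply: sub_finite_set => i /= fg1.
have [fi|] := pselect (f i = 1%g); last by left.
by right => gi; apply: fg1; rewrite fi gi mulg1.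
Qed.

Definition dsum_one : direct_sum := Sub _ dsum_one_subproof.
Definition dsum_inv f : direct_sum := Sub _ (dsum_inv_subproof f).
Definition dsum_mul f g : direct_sum := Sub _ (dsum_mul_subproof f g).

Lemma dsum_mulA : associative dsum_mul.
Proof. by move=> f g h; apply/val_inj/funext => i /=; rewrite mulgA. Qed.

Lemma dsum_1mul : left_id dsum_one dsum_mul.
Proof. by move=> f; apply/val_inj/funext => i /=; rewrite mul1g. Qed.

Lemma dsum_mul1 : right_id dsum_one dsum_mul.
Proof. by move=> f; apply/val_inj/funext => i /=; rewrite mulg1. Qed.

Lemma dsum_Vmul : left_inverse dsum_one dsum_inv dsum_mul.
Proof. by move=> f; apply/val_inj/funext => i /=; rewrite mulVg. Qed.

Lemma dsum_mulV : right_inverse dsum_one dsum_inv dsum_mul.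
Proof. by move=> f; apply/val_inj/funext => i /=; rewrite mulgV. Qed.

HB.instance Definition _ := isGroup.Build direct_sum
  dsum_mulA dsum_1mul dsum_mul1 dsum_Vmul dsum_mulV.

Definition dsum_factor (i : I) : set direct_sum :=
  [set f | forall j, j <> i -> val f j = 1%g].

End DirectSum.

Arguments dsum_factor {I} A i _.

(* G belongs to WR(A, B on I): the kernel of eps is a copy of A^(I), in which
   the factor A_i consists of the images of the functions supported in {i}. *)
Definition wreath_like (A B : groupType) (I : Type) (act : left_action B I)
    (G : groupType) : Prop :=
  exists (iota : {multiplicative direct_sum I A -> G})
         (eps : {multiplicative G -> B}),
    [/\ injective iota,
        range iota = eps @^-1` [set 1%g],
        range eps = [set: B] &
        forall (g : G) (i : I),
          [set (g * x * g^-1)%g | x in iota @` dsum_factor A i]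
          = iota @` dsum_factor A (act (eps g) i)].

Section Amenability.
Variable R : realType.

Definition bounded_function (T : Type) (f : T -> R) : Prop :=
  exists M, forall x, `|f x| <= M.

(* A left-invariant mean on l^oo(G); [m] is only constrained on bounded
   functions. *)
Definition invariant_mean (G : groupType) (m : (G -> R) -> R) : Prop :=
  [/\ forall (a b : R) (f h : G -> R),
        bounded_function f -> bounded_function h ->
        m (fun x => a * f x + b * h x) = a * m f + b * m h,
      forall f : G -> R,
        bounded_function f -> (forall x, 0 <= f x) -> 0 <= m f,
      m (fun=> 1) = 1 &
      forall (g : G) (f : G -> R),
        bounded_function f -> m (fun x => f (g^-1 * x)%g) = m f].

Definition amenable (G : groupType) : Prop :=
  exists m : (G -> R) -> R, invariant_mean m.

Definition amenable_stabilizers (G : groupType) (X : Type)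
    (act : left_action G X) : Prop :=
  forall x : X, amenable (stabilizer act x).

End Amenability.

Section Exactness.
Variable R : realType.

Record Prob (T : choiceType) := MkProb {
  pmass :> T -> R;
  pmass_ge0 : forall x, 0 <= pmass x;
  pmass_sum1 : (\esum_(x in [set: T]) (pmass x)%:E = 1)%E
}.

Definition l1dist (T : choiceType) (f h : T -> R) : \bar R :=
  (\esum_(x in [set: T]) `|f x - h x|%:E)%E.

Definition translate (G : groupType) (k : G) (f : G -> R) : G -> R :=
  fun g => f (k^-1 * g)%g.

(* Topological amenability of an action by homeomorphisms.  On Prob(G) the
   weak-* topology of l^1(G) = (c_0(G))^* is that of pointwise convergence, so
   weak-* continuity of [mu n] is continuity of each [fun x => mu n x g]. *)
Definition amenable_action (G : groupType) (X : topologicalType)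
    (act : left_action G X) : Prop :=
  (forall g, continuous (act g)) /\
  exists mu : nat -> X -> Prob G,
    (forall n g, continuous (fun x => mu n x g)) /\
    (forall k : G,
       ereal_sup (range (fun x =>
         l1dist (mu n (act k x)) (translate k (mu n x)))) @[n --> \oo]
       --> 0%E).

(* Exactness of a countable group in the sense of Ozawa (boundary amenability,
   or amenability at infinity), which by Ozawa and Guentner-Kaminker amounts to
   exactness of the reduced C*-algebra.  The empty space has to be excluded. *)
Definition exact_group (G : groupType) : Prop :=
  exists (X : topologicalType) (act : left_action G X),
    [/\ [set: X] !=set0, compact [set: X], hausdorff_space X &
        amenable_action act].

Definition bi_exact (G : groupType) : Prop :=
  exact_group G /\
  exists mu : G -> Prob G,
    forall h k : G,
      l1dist (mu (k * g * h)%g) (translate k (mu g))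
        @[g --> (@frechet_filter G : set_system G)] --> 0%E.

End Exactness.

(* Main.v *)
Require Import Defs.
From mathcomp Require Import all_boot all_order all_algebra.
From mathcomp Require Import all_classical all_reals all_analysis.
From mathcomp Require Import lra ring zify.
Import numFieldNormedType.Exports.
Import Order.TTheory GRing.Theory Num.Theory.

Set Implicit Arguments.
Unset Strict Implicit.
Unset Printing Implicit Defensive.

Local Open Scope classical_set_scope.
Local Open Scope ring_scope.

(* By a diagonal argument it suffices to find, for every finite K in G and every
   e > 0, a map F : G -> Prob(G) with |F(kgh) - k F(g)| <= e for k, h in K and all
   but finitely many g.  Let N = A^(I) be the kernel of eps : G -> B.  Since N is
   amenable, probability measures on B can be lifted to G, almost equivariantly,
   by spreading each fibre with an almost invariant measure on N.  Hence the
   compact B-space X that witnesses exactness of B also witnesses exactness of G,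
   and there is an almost equivariant map X -> Prob(G).  Its restriction to an
   orbit gives zeta_B : B -> Prob(G), and averaging it over the amenable
   stabilizers gives zeta_I : I -> Prob(G), almost equivariant uniformly on I.
   - As long as eps(g) tends to infinity, push mu_B(eps g), given by bi-exactness
     of B, forward along zeta_B.
   - As long as eps(g) stays in a finite set, write g = n s(eps g) with n in N;
     then n tends to infinity.  Give i the weight l(n_i), where l is a proper
     length on G and the coordinate n_i lies in a copy of A in G, normalize, and
     push forward along zeta_I.  Conjugation and multiplication change the
     weights negligibly compared to their sum.
   F interpolates between the two maps with a slowly varying function of eps(g). *)

(** * Probability measures on discrete sets and their l^1 distance *)

Section Sums.
Variable R : realType.

(** Valued in [\bar R], as a supremum of finite partial sums, so that inequalities need no prior
    summability. *)
Definition sumT (T : choiceType) (f : T -> R) : \bar R :=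
  (\esum_(x in [set: T]) (f x)%:E)%E.

Implicit Types T U : choiceType.

Lemma sumT_ge0 T (f : T -> R) : (forall t, 0 <= f t) -> (0 <= sumT f)%E.
Proof. by move=> f0; apply: esum_ge0 => t _; rewrite lee_fin. Qed.

Lemma le_sumT T (f g : T -> R) :
  (forall t, f t <= g t) -> (sumT f <= sumT g)%E.
Proof. by move=> fg; apply: le_esum => t _; rewrite lee_fin. Qed.

Lemma eq_sumT T (f g : T -> R) : f =1 g -> sumT f = sumT g.
Proof. by move=> /funext ->. Qed.

Lemma sumTD T (f g : T -> R) :
  (forall t, 0 <= f t) -> (forall t, 0 <= g t) ->
  sumT (fun t => f t + g t) = (sumT f + sumT g)%E.
Proof.
move=> f0 g0; rewrite /sumT -esumD//.
- by move=> t _; rewrite lee_fin.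
- by move=> t _; rewrite lee_fin.
Qed.

Lemma ge_sumT T (f : T -> R) (c : \bar R) :
  (forall s : seq T, uniq s -> ((\sum_(t <- s) f t)%:E <= c)%E) ->
  (sumT f <= c)%E.
Proof.
move=> H; apply: ge_ereal_sup => _ [X [finX _] <-].
by rewrite fsbig_finite//= sumEFin; apply: H.
Qed.

Lemma sum_le_sumT T (f : T -> R) (s : seq T) :
  uniq s -> ((\sum_(t <- s) f t)%:E <= sumT f)%E.
Proof.
move=> us; apply: esum_ge; exists [set` s].
  by split=> //; exact: finite_seq.
by rewrite -fsbig_seq// sumEFin.
Qed.

Lemma le_sumT1 T (f : T -> R) t : ((f t)%:E <= sumT f)%E.
Proof. by have := @sum_le_sumT _ f [:: t] isT; rewrite big_seq1. Qed.

(** Finite partial sums give one inequality; the other is the same inequality for [c^-1]. *)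
Lemma sumTZ T (c : R) (f : T -> R) : 0 <= c -> (forall t, 0 <= f t) ->
  sumT (fun t => c * f t) = (c%:E * sumT f)%E.
Proof.
move=> + f0; have le (d : R) (g : T -> R) : 0 < d -> (forall t, 0 <= g t) ->
    (sumT (fun t => d * g t)%R <= d%:E * sumT g)%E.
  move=> d0 g0; apply: ge_sumT => s us.
  by rewrite -mulr_sumr EFinM lee_pmul2l// ?sum_le_sumT// lte_fin.
rewrite le_eqVlt => /predU1P[<-|c0].
  by rewrite mul0e /sumT esum1// => t _; rewrite mul0r.
apply/eqP; rewrite eq_le le//= -(@lee_pmul2l _ c^-1%:E)// ?lte_fin ?invr_gt0//.
rewrite muleA -EFinM mulVf ?gt_eqF// mul1e.
apply: le_trans (le c^-1 (fun t => c * f t) _ _); last 2 first.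
- by rewrite invr_gt0.
- by move=> t; rewrite mulr_ge0// ltW.
by apply: le_sumT => t; rewrite mulrA mulVf ?gt_eqF// mul1r.
Qed.

Lemma exchange_sumT T U (f : T -> U -> R) : (forall t u, 0 <= f t u) ->
  (\esum_(t in [set: T]) sumT (f t) =
   \esum_(u in [set: U]) sumT (fun t => f t u))%E.
Proof.
move=> f0; rewrite /sumT !esum_esum; try by move=> *; rewrite lee_fin.
rewrite (reindex_esum ([set: U] `*` [set: T]) _ (fun x => (x.2, x.1)))//.
by split=> //= [[a b] [c d] _ _ [-> ->]//|[a b] _]; exists (b, a).
Qed.

Lemma reindex_sumT T U (e : T -> U) (f : U -> R) : bijective e ->
  sumT f = sumT (fun t => f (e t)).
Proof.
move=> [e' eK e'K]; apply: reindex_esum; split=> //.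
- by move=> x y _ _; apply: can_inj eK _ _.
- by move=> y _; exists (e' y).
Qed.

(** Finiteness of both sums makes [fine] harmless; the bound is [a <= b + |a - b|] summed, used in
    both directions. *)
Lemma le_dist_fine_sumT T (a b : T -> R) :
  (forall t, 0 <= a t) -> (forall t, 0 <= b t) ->
  (sumT a < +oo)%E -> (sumT b < +oo)%E ->
  (`|fine (sumT a) - fine (sumT b)|%:E <= sumT (fun t => `|a t - b t|%R))%E.
Proof.
move=> a0 b0 fa fb.
have leD (c d : T -> R) : (forall t, 0 <= c t) -> (forall t, 0 <= d t) ->
    (sumT c <= sumT d + sumT (fun t => `|c t - d t|%R))%E.
  move=> c0 d0; rewrite -sumTD//; apply: le_sumT => t.
  by rewrite -lerBlDl ler_norm.
have [ga gb] : sumT a \is a fin_num /\ sumT b \is a fin_num.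
  by rewrite !ge0_fin_numE// sumT_ge0.
move: (leD _ _ a0 b0) (leD _ _ b0 a0).
rewrite (_ : sumT (fun t => `|b t - a t|) = sumT (fun t => `|a t - b t|)).
  rewrite -(fineK ga) -(fineK gb) /=.
  case: (sumT (fun t => `|a t - b t|%R)) => [r| |]; rewrite ?leey//.
  by rewrite -!EFinD !lee_fin ler_norml => *; apply/andP; split; lra.
by apply: eq_sumT => t; rewrite distrC.
Qed.

Lemma sumT_indicator T (t0 : T) (c : R) : 0 <= c ->
  sumT (fun t => if t == t0 then c else 0) = c%:E.
Proof.
move=> c0; rewrite /sumT (esumID [set t0]); last first.
  by move=> t _; case: ifP; rewrite lee_fin.
rewrite setTI esum_set1 ?eqxx ?lee_fin// setTI esum1 ?adde0// => t /= /eqP.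
by move/negbTE ->.
Qed.

End Sums.

Section L1dist.
Variable R : realType.
Implicit Types T U : choiceType.

Lemma l1distE T (f h : T -> R) : l1dist f h = sumT (fun t => `|f t - h t|).
Proof. by []. Qed.

Lemma l1dist_ge0 T (f h : T -> R) : (0 <= l1dist f h)%E.
Proof. exact: sumT_ge0. Qed.

Lemma l1distxx T (f : T -> R) : l1dist f f = 0%E.
Proof. by rewrite /l1dist esum1// => t _; rewrite subrr normr0. Qed.

Lemma l1dist_sym T (f h : T -> R) : l1dist f h = l1dist h f.
Proof. by apply: eq_sumT => t; rewrite distrC. Qed.

Lemma sumT_pmass T (p : Prob R T) : sumT p = 1%E.
Proof. exact: pmass_sum1. Qed.

Lemma l1dist_le2 T (p q : Prob R T) : (l1dist p q <= 2%:E)%E.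
Proof.
apply: (@le_trans _ _ (sumT (fun t => p t + q t))).
  apply: le_sumT => t; rewrite (le_trans (ler_normB _ _))//.
  by rewrite !ger0_norm ?pmass_ge0.
rewrite sumTD ?sumT_pmass//; try exact: pmass_ge0.
Qed.

Lemma pmass_le1 T (p : Prob R T) t : p t <= 1.
Proof. by rewrite -lee_fin -(sumT_pmass p) le_sumT1. Qed.

Lemma l1dist_reindex T U (e : T -> U) (f h : U -> R) : bijective e ->
  l1dist (fun t => f (e t)) (fun t => h (e t)) = l1dist f h.
Proof. by move=> be; rewrite !l1distE [RHS](reindex_sumT _ be). Qed.

Lemma Prob_ext T (p q : Prob R T) : p =1 q -> p = q.
Proof.
case: p q => p p0 p1 [q q0 q1] /= /funext pq; move: p0 p1 q0 q1.
by rewrite pq => p0 p1 q0 q1; congr MkProb; exact: Prop_irrelevance.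
Qed.

Section Dirac.
Variables (T : choiceType) (t0 : T).
Let f t : R := if t == t0 then 1 else 0.
Fact dirac_ge0 t : 0 <= f t. Proof. by rewrite /f; case: ifP. Qed.
Fact dirac_sum1 : (\esum_(t in [set: T]) (f t)%:E = 1)%E.
Proof. exact: sumT_indicator. Qed.
Definition dirac_prob := MkProb dirac_ge0 dirac_sum1.
End Dirac.

Section Bind.
Variables (T U : choiceType) (p : Prob R T) (q : T -> Prob R U).
Let f u : R := fine (sumT (fun t => p t * q t u)).
Let pq_ge0 t u : 0 <= p t * q t u.
Proof. by rewrite mulr_ge0 ?pmass_ge0. Qed.
Let pq_le u : (sumT (fun t => p t * q t u)%R <= 1)%E.
Proof.
rewrite -(sumT_pmass p); apply: le_sumT => t.
by rewrite ler_piMr ?pmass_ge0 ?pmass_le1.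
Qed.
Lemma bind_fin u : (sumT (fun t => p t * q t u)%R < +oo)%E.
Proof. by apply: (le_lt_trans (pq_le u)); rewrite ltry. Qed.
Let fE u : (f u)%:E = sumT (fun t => p t * q t u).
Proof. by rewrite fineK// ge0_fin_numE ?bind_fin// sumT_ge0. Qed.
Fact bind_ge0 u : 0 <= f u.
Proof. by rewrite fine_ge0// sumT_ge0. Qed.
Fact bind_sum1 : (\esum_(u in [set: U]) (f u)%:E = 1)%E.
Proof.
under eq_esum do rewrite fE.
rewrite -exchange_sumT// -(sumT_pmass p); apply: eq_esum => t _.
rewrite sumTZ ?pmass_ge0//; last exact: pmass_ge0.
by rewrite sumT_pmass mule1.
Qed.
(** The mixture of the measures [q t] with weights [p t]; push-forwards and convolutions are special
    cases. *)
Definition bind := MkProb bind_ge0 bind_sum1.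
Lemma bindE u : bind u = fine (sumT (fun t => p t * q t u)).
Proof. by []. Qed.
End Bind.

(** Split [p' q' - p q] as [(p' - p) q' + p (q' - q)] and use that each [q' t] has mass 1. The
    kernels are compared only where [p] has mass, which allows estimates valid on the support of [p]
    alone. *)
Lemma l1dist_bind T U (p' p : Prob R T) (q' q : T -> Prob R U) (d : T -> R) :
  (forall t, 0 <= d t) ->
  (forall t, p t != 0 -> (l1dist (q' t) (q t) <= (d t)%:E)%E) ->
  (l1dist (bind p' q') (bind p q) <=
   l1dist p' p + sumT (fun t => p t * d t)%R)%E.
Proof.
move=> d0 dq.
apply: (@le_trans _ _ (\esum_(u in [set: U])
    sumT (fun t => `|p' t * q' t u - p t * q t u|)%R)).
  apply: le_esum => u _; rewrite !bindE; apply: le_dist_fine_sumT.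
  - by move=> t; rewrite mulr_ge0 ?pmass_ge0.
  - by move=> t; rewrite mulr_ge0 ?pmass_ge0.
  - exact: bind_fin.
  - exact: bind_fin.
rewrite -exchange_sumT//.
rewrite l1distE -sumTD//; last by move=> t; rewrite mulr_ge0 ?pmass_ge0.
apply: le_esum => t _.
apply: (@le_trans _ _ (sumT (fun u => `|p' t - p t| * q' t u +
    p t * `|q' t u - q t u|))).
  apply: le_sumT => u.
  rewrite (_ : _ - _ = (p' t - p t) * q' t u + p t * (q' t u - q t u)).
    rewrite (le_trans (ler_normD _ _))// !normrM.
    by rewrite (ger0_norm (pmass_ge0 _ _)) (ger0_norm (pmass_ge0 p _)).
  by ring.
rewrite sumTD; last 2 first.
- by move=> u; rewrite mulr_ge0 ?pmass_ge0.
- by move=> u; rewrite mulr_ge0 ?pmass_ge0.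
rewrite (sumTZ (normr_ge0 (p' t - p t)) (pmass_ge0 (q' t))).
rewrite (sumT_pmass (q' t)) mule1 EFinD leeD2l// sumTZ ?pmass_ge0// EFinM.
have [->|pt0] := eqVneq (p t) 0; first by rewrite !mul0e.
by rewrite lee_pmul ?lee_fin ?pmass_ge0 ?dq ?l1dist_ge0.
Qed.

Lemma l1dist_bind_le T U (p' p : Prob R T) (q' q : T -> Prob R U) (a c b : R) :
  (forall t, p t != 0 -> (l1dist (q' t) (q t) <= c%:E)%E) ->
  (l1dist p' p <= a%:E)%E -> 0 <= c -> a + c <= b ->
  (l1dist (bind p' q') (bind p q) <= b%:E)%E.
Proof.
move=> dq pp c0 acb.
apply: (le_trans (@l1dist_bind _ _ _ _ _ _ (fun=> c) _ _)) => //.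
rewrite (eq_sumT (g := fun t => c * p t)); last by move=> t; rewrite mulrC.
rewrite sumTZ//; last exact: pmass_ge0.
by rewrite sumT_pmass mule1; apply: le_trans (leeD2r _ pp) _; rewrite -EFinD lee_fin.
Qed.

Section Reindex.
Variables (T : choiceType) (e : T -> T) (be : bijective e) (p : Prob R T).
Fact precomp_ge0 t : 0 <= p (e t). Proof. exact: pmass_ge0. Qed.
Fact precomp_sum1 : (\esum_(t in [set: T]) (p (e t))%:E = 1)%E.
Proof. by rewrite -(sumT_pmass p) (reindex_sumT p be). Qed.
(** The push-forward of [p] under the inverse of [e]. *)
Definition precomp := MkProb precomp_ge0 precomp_sum1.
End Reindex.

Lemma bind_precomp T U (e : T -> T) (be : bijective e) (p : Prob R T)
    (q : T -> Prob R U) : bind (precomp be p) (fun t => q (e t)) = bind p q.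
Proof.
by apply: Prob_ext => u; rewrite !bindE (reindex_sumT (fun t => p t * q t u) be).
Qed.

Section Group.
Variable G : groupType.
Implicit Types (k : G) (p : Prob R G).

Lemma mulgI_bij k : bijective (fun g : G => (k * g)%g).
Proof. by exists (fun g => (k^-1 * g)%g) => g; rewrite mulgA ?mulVg ?mulgV mul1g. Qed.

Definition ptranslate k p : Prob R G := precomp (mulgI_bij k^-1%g) p.

Lemma l1dist_translate k (f h : G -> R) :
  l1dist (translate k f) (translate k h) = l1dist f h.
Proof. exact: l1dist_reindex (mulgI_bij _). Qed.

Lemma ptranslate_bind T k (p : Prob R T) (q : T -> Prob R G) :
  ptranslate k (bind p q) = bind p (fun t => ptranslate k (q t)).
Proof. exact: Prob_ext. Qed.

(** Reindexing the first mixture by [e] matches [q (e t)] with [translate k (q t)]: the defect of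
    the mixture is that of [p] under [e] plus the [p]-average of the equivariance defect of [q]. *)
Lemma l1dist_bind_translate T (e : T -> T) (p' p : Prob R T)
    (q : T -> Prob R G) k (d : T -> R) : bijective e ->
  (forall t, 0 <= d t) ->
  (forall t, p t != 0 -> (l1dist (q (e t)) (translate k (q t)) <= (d t)%:E)%E) ->
  (l1dist (bind p' q) (translate k (bind p q)) <=
   l1dist (fun t => p' (e t)) p + sumT (fun t => p t * d t)%R)%E.
Proof.
move=> be d0 dq; rewrite -(bind_precomp be).
rewrite (_ : translate k _ = ptranslate k (bind p q))//.
rewrite ptranslate_bind; exact: (@l1dist_bind _ _ (precomp be p') p (fun t => q (e t))).
Qed.

Lemma l1dist_bind_translate_le T (e : T -> T) (p' p : Prob R T)
    (q : T -> Prob R G) k (a c b : R) : bijective e ->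
  (forall t, p t != 0 -> (l1dist (q (e t)) (translate k (q t)) <= c%:E)%E) ->
  (l1dist (fun t => p' (e t)) p <= a%:E)%E -> 0 <= c -> a + c <= b ->
  (l1dist (bind p' q) (translate k (bind p q)) <= b%:E)%E.
Proof.
move=> be dq pp c0 acb.
rewrite -(bind_precomp be) (_ : translate k _ = ptranslate k (bind p q))//.
rewrite ptranslate_bind.
exact: (@l1dist_bind_le _ _ (precomp be p') p (fun t => q (e t)) _ a c b).
Qed.

End Group.

Section Normalize.
Variables (T : choiceType) (w : T -> R) (W : R).
Hypotheses (w0 : forall t, 0 <= w t) (wW : sumT w = W%:E) (W0 : 0 < W).
Fact normalize_ge0 t : 0 <= W^-1 * w t.
Proof. by rewrite mulr_ge0// invr_ge0 ltW. Qed.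
Fact normalize_sum1 : (\esum_(t in [set: T]) (W^-1 * w t)%:E = 1)%E.
Proof.
rewrite -/(sumT (fun t => W^-1 * w t)) sumTZ ?invr_ge0 ?(ltW W0)//.
by rewrite wW -EFinM mulVf ?gt_eqF.
Qed.
Definition normalize := MkProb normalize_ge0 normalize_sum1.
End Normalize.

(** The factor 2 has one [D] for the change of the weights and one for the change of the total mass,
    itself at most [D]. *)
Lemma l1dist_normalize T (w' w : T -> R) (W' W D : R)
    (w'0 : forall t, 0 <= w' t) (w'W : sumT w' = W'%:E) (W'0 : 0 < W')
    (w0 : forall t, 0 <= w t) (wW : sumT w = W%:E) (W0 : 0 < W) :
  (l1dist w' w <= D%:E)%E ->
  (l1dist (normalize w'0 w'W W'0) (normalize w0 wW W0) <= (2 * D / W)%:E)%E.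
Proof.
move=> wD; have [iW iW'] : 0 <= W^-1 /\ 0 <= W'^-1.
  by split; rewrite invr_ge0 ltW.
have W'W : `|W' - W| <= D.
  rewrite -lee_fin; apply: le_trans wD.
  have := @le_dist_fine_sumT _ _ w' w w'0 w0.
  by rewrite w'W wW /= !ltry; apply.
apply: (@le_trans _ _ (sumT (fun t => `|W - W'| / W * (W'^-1 * w' t) +
    W^-1 * `|w' t - w t|))).
  apply: le_sumT => t /=.
  rewrite (_ : _ - _ = (W - W') / W * (W'^-1 * w' t) + W^-1 * (w' t - w t)).
    rewrite (le_trans (ler_normD _ _))// !normrM.
    by rewrite (ger0_norm (w'0 _)) (@gtr0_norm _ W^-1) ?(@gtr0_norm _ W'^-1) ?invr_gt0.
  by field; rewrite !gt_eqF.
rewrite sumTD; last 2 first.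
- by move=> t; apply: mulr_ge0; apply: mulr_ge0.
- by move=> t; apply: mulr_ge0.
rewrite sumTZ; last 2 first.
- exact: mulr_ge0.
- by move=> t; apply: mulr_ge0.
rewrite (sumT_pmass (normalize w'0 w'W W'0)) mule1 sumTZ//.
rewrite -l1distE.
apply: (@le_trans _ _ ((D / W)%:E + (D / W)%:E)%E); last first.
  by rewrite -EFinD lee_fin; lra.
rewrite leeD//; first by rewrite lee_fin ler_pM2r ?invr_gt0// distrC.
by rewrite mulrC EFinM lee_pmul2l// lte_fin invr_gt0.
Qed.

End L1dist.

(** * Calculus of means on bounded functions *)

Section Mean.
Variables (R : realType) (H : groupType) (m : (H -> R) -> R).
Hypothesis mean_m : invariant_mean m.
Implicit Types f g : H -> R.

Lemma bounded_function_cst (c : R) : bounded_function (fun _ : H => c).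
Proof. by exists `|c|. Qed.

Lemma bounded_functionD f g : bounded_function f -> bounded_function g ->
  bounded_function (fun x => f x + g x).
Proof.
move=> [M HM] [M' HM']; exists (M + M') => x.
by rewrite (le_trans (ler_normD _ _))// lerD.
Qed.

Lemma bounded_functionN f : bounded_function f -> bounded_function (fun x => - f x).
Proof. by move=> [M HM]; exists M => x; rewrite normrN. Qed.

Lemma bounded_function_norm f : bounded_function f -> bounded_function (fun x => `|f x|).
Proof. by move=> [M HM]; exists M => x; rewrite normr_id. Qed.

Lemma bounded_function_sum (T : Type) (s : seq T) (f : T -> H -> R) :
  (forall t, bounded_function (f t)) ->
  bounded_function (fun x => \sum_(t <- s) f t x).
Proof.
move=> bf; elim: s => [|t s IH].
  by exists 0 => x; rewrite big_nil normr0.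
rewrite (_ : (fun _ => _) = (fun x => f t x + \sum_(t <- s) f t x)).
  exact: bounded_functionD.
by apply/funext => x; rewrite big_cons.
Qed.

Lemma meanD f g : bounded_function f -> bounded_function g ->
  m (fun x => f x + g x) = m f + m g.
Proof.
move=> bf bg; have [mlin _ _ _] := mean_m.
by have := mlin 1 1 f g bf bg; rewrite !mul1r => <-; congr m; apply/funext => x;
   rewrite !mul1r.
Qed.

Lemma meanB f g : bounded_function f -> bounded_function g ->
  m (fun x => f x - g x) = m f - m g.
Proof.
move=> bf bg; have [mlin _ _ _] := mean_m.
by have := mlin 1 (-1) f g bf bg; rewrite mul1r mulN1r => <-; congr m;
   apply/funext => x; rewrite mul1r mulN1r.
Qed.

Lemma mean_cst c : m (fun=> c) = c.
Proof.
have [mlin _ m1 _] := mean_m.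
have := mlin c 0 _ _ (bounded_function_cst 1) (bounded_function_cst 1).
by rewrite m1 mulr1 mul0r addr0.
Qed.

Lemma le_mean f g : bounded_function f -> bounded_function g ->
  (forall x, f x <= g x) -> m f <= m g.
Proof.
move=> bf bg fg; have [_ mpos _ _] := mean_m.
rewrite -subr_ge0 -meanB//; apply: mpos; last by move=> x; rewrite subr_ge0.
by apply: bounded_functionD => //; exact: bounded_functionN.
Qed.

Lemma mean_sum (T : Type) (s : seq T) (f : T -> H -> R) :
  (forall t, bounded_function (f t)) ->
  m (fun x => \sum_(t <- s) f t x) = \sum_(t <- s) m (f t).
Proof.
move=> bf; elim: s => [|t s IH].
  by rewrite big_nil -[RHS]mean_cst; congr m; apply/funext => x; rewrite big_nil.
rewrite big_cons -IH -meanD//; last exact: bounded_function_sum.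
by congr m; apply/funext => x; rewrite big_cons.
Qed.

Lemma mean_dist f g : bounded_function f -> bounded_function g ->
  `|m f - m g| <= m (fun x => `|f x - g x|).
Proof.
move=> bf bg; have bfg : bounded_function (fun x => f x - g x).
  by apply: bounded_functionD => //; exact: bounded_functionN.
have bn := bounded_function_norm bfg.
rewrite -meanB// ler_norml; apply/andP; split; last first.
  by apply: le_mean => // x; exact: ler_norm.
rewrite lerNl -[leLHS]add0r -(mean_cst 0) -meanB//; last exact: bounded_function_cst.
apply: le_mean => //.
  by apply: bounded_functionD; [exact: bounded_function_cst|exact: bounded_functionN].
by move=> x; rewrite sub0r -normrN ler_norm.
Qed.

Lemma mean_translate (g : H) f : bounded_function f ->
  m (fun x => f (g * x)%g) = m f.
Proof.
by move=> bf; have [_ _ _ /(_ g^-1%g _ bf)] := mean_m; rewrite invgK.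
Qed.

End Mean.

(** * Invariant means and almost invariant measures *)

Section HahnBanach.
Variable R : realType.
Implicit Types A B C : set R.

Lemma inf_le_add A B C : A !=set0 -> B !=set0 -> has_lbound C ->
  (forall a b, A a -> B b -> exists2 c, C c & c <= a + b) ->
  inf C <= inf A + inf B.
Proof.
move=> A0 B0 lC H; rewrite -lerBlDr; apply: lb_le_inf => // a Aa.
rewrite lerBlDr -lerBlDl; apply: lb_le_inf => // b Bb; rewrite lerBlDl.
by have [c Cc cab] := H _ _ Aa Bb; apply: le_trans cab; exact: ge_inf.
Qed.

Lemma inf_le_scale A C t : 0 <= t -> A !=set0 -> has_lbound C ->
  (forall a, A a -> exists2 c, C c & c <= t * a) ->
  inf C <= t * inf A.
Proof.
rewrite le_eqVlt => /predU1P[<- [a Aa] lC H|t0 A0 lC H].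
  have [c Cc] := H _ Aa; rewrite !mul0r; apply: le_trans; exact: ge_inf.
rewrite mulrC -ler_pdivrMr//; apply: lb_le_inf => // a Aa.
rewrite ler_pdivrMr// mulrC.
by have [c Cc cab] := H _ Aa; apply: le_trans cab; exact: ge_inf.
Qed.

Variables (V : lmodType R) (D : set V).
Hypotheses (D0 : D 0) (DD : forall v w, D v -> D w -> D (v + w))
  (DZ : forall t v, D v -> D (t *: v)).

(** Everything is relative to the subspace [D], off which [q] is arbitrary. Homogeneity is asked as
    an inequality only; the converse follows by scaling with [t^-1]. *)
Definition sublinear (q : V -> R) :=
  (forall v w, D v -> D w -> q (v + w) <= q v + q w) /\
  (forall t v, 0 <= t -> D v -> q (t *: v) <= t * q v).

Let DN v : D v -> D (- v). Proof. by rewrite -scaleN1r; exact: DZ. Qed.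

Let sublinear0 q : sublinear q -> q 0 = 0.
Proof.
move=> [qD qZ]; apply/eqP; rewrite eq_le; apply/andP; split.
  by have := qZ 0 0 (lexx _) D0; rewrite scaler0 mul0r.
by have := qD _ _ D0 D0; rewrite addr0; lra.
Qed.

Let sublinearN q v : sublinear q -> D v -> - q (- v) <= q v.
Proof.
move=> sq Dv; have [+ _] := sq => /(_ _ _ Dv (DN Dv)).
by rewrite subrr (sublinear0 sq); lra.
Qed.

Let le_sublinearZ q t v : sublinear q -> 0 <= t -> D v -> t * q v <= q (t *: v).
Proof.
move=> sq; rewrite le_eqVlt => /predU1P[<-|t0] Dv.
  by rewrite scale0r mul0r (sublinear0 sq).
have [_ qZ] := sq; have := qZ t^-1 (t *: v).
rewrite scalerA mulVf ?gt_eqF// scale1r invr_ge0 ltW// => /(_ isT (DZ _ Dv)).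
by rewrite mulrC ler_pdivlMr// mulrC.
Qed.

(* For [x] in [D] the functional [v |-> inf_(t >= 0) (q (v + t x) - t q x)] is
   sublinear and below [q]; if it equals [q], its value at [- x] (take [t = 1])
   gives [q (- x) <= - q x]. *)
Lemma minimal_sublinear_additive q : sublinear q ->
  (forall q', sublinear q' -> (forall v, D v -> q' v <= q v) ->
    forall v, D v -> q v <= q' v) ->
  forall v w, D v -> D w -> q (v + w) = q v + q w.
Proof.
move=> sq qmin.
suff qN x : D x -> q (- x) <= - q x.
  move=> v w Dv Dw; have [qD _] := sq; apply/eqP; rewrite eq_le qD//=.
  have := qD _ _ (DD Dv Dw) (DN Dw); rewrite addrK.
  by have := qN _ Dw; lra.
move=> Dx.
pose S v := [set q (v + t *: x) - t * q x | t in [set t | 0 <= t]].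
have S0 v : S v !=set0 by exists (q (v + 0 *: x) - 0 * q x); exists 0 => /=.
have lS v : D v -> has_lbound (S v).
  move=> Dv; exists (- q (- v)) => _ [t /= t0 <-].
  have [+ _] := sq => /(_ _ _ (DD Dv (DZ t Dx)) (DN Dv)).
  rewrite addrAC subrr add0r.
  by have := le_sublinearZ sq t0 Dx; lra.
have sS : sublinear (fun v => inf (S v)).
  have [qD qZ] := sq; split.
    move=> v w Dv Dw; apply: inf_le_add => //; first exact/lS/DD.
    move=> _ _ [t /= t0 <-] [s /= s0 <-].
    exists (q (v + w + (t + s) *: x) - (t + s) * q x).
      by exists (t + s) => //=; exact: addr_ge0.
    have := qD _ _ (DD Dv (DZ t Dx)) (DD Dw (DZ s Dx)).
    by rewrite addrACA -scalerDl; lra.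
  move=> c v c0 Dv; apply: inf_le_scale => //; first exact/lS/DZ.
  move=> _ [t /= t0 <-]; exists (q (c *: v + (c * t) *: x) - (c * t) * q x).
    by exists (c * t) => //=; exact: mulr_ge0.
  have := qZ _ _ c0 (DD Dv (DZ t Dx)).
  by rewrite scalerDr scalerA; lra.
have := qmin _ sS _ (- x) (DN Dx).
move=> /(_ _)/le_trans; apply.
  move=> v Dv; apply: ge_inf; first exact: lS.
  by exists 0 => //=; rewrite scale0r addr0 mul0r subr0.
apply: ge_inf; first exact/lS/DN.
by exists 1 => //=; rewrite scale1r addNr (sublinear0 sq) mul1r sub0r.
Qed.

(** Zorn's lemma gives a minimal sublinear functional below [p], and minimality makes it additive. A
    nonempty chain is bounded by its pointwise infimum, which is finite since its members satisfy
    [q v >= - p (- v)]. *)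
Lemma hahn_banach p : sublinear p ->
  exists l : V -> R, (forall v w, D v -> D w -> l (v + w) = l v + l w) /\
    (forall v, D v -> l v <= p v).
Proof.
move=> sp.
pose T := {q : V -> R | sublinear q /\ forall v, D v -> q v <= p v}.
(* The order is reversed, so that the maximal element of Zorn's lemma is a minimal functional. *)
pose leT (q r : T) := `[< forall v, D v -> sval r v <= sval q v >].
have t0 : T by exists p.
have [||C totC|[q [sq qp]] qmax] := @ZL_preorder T t0 leT.
- by move=> q; apply/asboolP.
- by move=> r q s /asboolP qr /asboolP rs; apply/asboolP => v Dv;
    exact: le_trans (rs _ Dv) (qr _ Dv).
- have [[q0 Cq0]|C0] := pselect (C !=set0); last first.
    by exists t0 => q Cq; exfalso; apply: C0; exists q.
  pose S v := [set sval q v | q in C].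
  have S0 v : S v !=set0 by exists (sval q0 v); exists q0.
  have lS v : D v -> has_lbound (S v).
    move=> Dv; exists (- p (- v)) => _ [[q [sq qp]] /= _ <-].
    by apply: le_trans (sublinearN sq Dv); rewrite lerN2 qp//; exact: DN.
  have sS : sublinear (fun v => inf (S v)).
    split.
      move=> v w Dv Dw; apply: inf_le_add => //; first exact/lS/DD.
      move=> _ _ [q Cq <-] [r Cr <-].
      have [/asboolP qr|/asboolP rq] := totC _ _ Cq Cr.
        exists (sval r (v + w)); first by exists r.
        have [[rD _] _] := svalP r; apply: le_trans (rD _ _ Dv Dw) _.
        by rewrite lerD2r qr.
      exists (sval q (v + w)); first by exists q.
      have [[qD _] _] := svalP q; apply: le_trans (qD _ _ Dv Dw) _.
      by rewrite lerD2l rq.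
    move=> c v c0 Dv; apply: inf_le_scale => //; first exact/lS/DZ.
    move=> _ [q Cq <-]; exists (sval q (c *: v)); first by exists q.
    by have [[_ qZ] _] := svalP q; exact: qZ.
  have Sq q v : C q -> D v -> inf (S v) <= sval q v.
    by move=> Cq Dv; apply: ge_inf; [exact: lS|exists q].
  have Sp v : D v -> inf (S v) <= p v.
    by move=> Dv; apply: le_trans (Sq _ _ Cq0 Dv) _; have [_] := svalP q0; exact.
  exists (exist _ (fun v => inf (S v)) (conj sS Sp) : T) => q Cq.
  apply/asboolP => v Dv /=.
  exact: Sq.
exists q; split=> //; apply: minimal_sublinear_additive => // q' sq' q'q v Dv.
have q'p w : D w -> q' w <= p w by move=> Dw; exact: le_trans (q'q _ Dw) (qp _ Dw).
have := qmax (exist _ q' (conj sq' q'p) : T).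
by move=> /(_ _)/asboolP; apply=> //; apply/asboolP.
Qed.

(* Hahn-Banach applied to [v |-> inf (N (v + c) - mu)] over [(c, mu)] in [Q];
   evaluating at [- c] gives the lower bound for [l c]. *)
Lemma cone_separation (N : V -> R) (Q : V -> R -> Prop) :
  sublinear N -> Q 0 0 ->
  (forall c d mu nu, Q c mu -> Q d nu -> Q (c + d) (mu + nu)) ->
  (forall t c mu, 0 <= t -> Q c mu -> Q (t *: c) (t * mu)) ->
  (forall c mu, Q c mu -> D c /\ mu <= N c) ->
  exists l : V -> R, [/\ forall v w, D v -> D w -> l (v + w) = l v + l w,
    forall v, D v -> l v <= N v & forall c mu, Q c mu -> mu <= l c].
Proof.
move=> sN Q0 QD QZ QN.
pose S v := [set x | exists c mu, Q c mu /\ x = N (v + c) - mu].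
have S0 v : S v !=set0 by exists (N (v + 0) - 0); exists 0, 0.
have lS v : D v -> has_lbound (S v).
  move=> Dv; exists (- N (- v)) => _ [c [mu [Qc ->]]].
  have [Dc muN] := QN _ _ Qc; have [+ _] := sN.
  move=> /(_ _ _ (DD Dv Dc) (DN Dv)); rewrite addrAC subrr add0r; lra.
have sS : sublinear (fun v => inf (S v)).
  have [ND NZ] := sN; split.
    move=> v w Dv Dw; apply: inf_le_add => //; first exact/lS/DD.
    move=> _ _ [c [mu [Qc ->]]] [d [nu [Qd ->]]].
    exists (N (v + w + (c + d)) - (mu + nu)).
      by exists (c + d), (mu + nu); split=> //; exact: QD.
    have [[Dc _] [Dd _]] := (QN _ _ Qc, QN _ _ Qd).
    by have := ND _ _ (DD Dv Dc) (DD Dw Dd); rewrite addrACA; lra.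
  move=> t v t0 Dv; apply: inf_le_scale => //; first exact/lS/DZ.
  move=> _ [c [mu [Qc ->]]]; exists (N (t *: v + t *: c) - t * mu).
    by exists (t *: c), (t * mu); split=> //; exact: QZ.
  have [Dc _] := QN _ _ Qc.
  by have := NZ _ _ t0 (DD Dv Dc); rewrite scalerDr; lra.
have [l [lD lS']] := hahn_banach sS; exists l; split=> //.
  move=> v Dv; apply: le_trans (lS' _ Dv) _.
  by apply: ge_inf; [exact: lS|exists 0, 0; rewrite addr0 subr0].
move=> c mu Qc; have [Dc _] := QN _ _ Qc.
have l0 : l 0 = 0 by have := lD _ _ D0 D0; rewrite addr0; lra.
have := lD _ _ Dc (DN Dc); rewrite subrr l0.
suff : l (- c) <= - mu by lra.
apply: le_trans (lS' _ (DN Dc)) _; apply: ge_inf; first exact/lS/DN.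
by exists c, mu; rewrite addNr (sublinear0 sN) sub0r.
Qed.

End HahnBanach.

(** * Almost invariant measures from an invariant mean *)

Section Reiter.
Variable R : realType.

Definition reiter (G : groupType) : Prop :=
  forall (K : seq G) (e : R), 0 < e ->
    exists nu : Prob R G, forall k, k \in K ->
      (l1dist (translate k nu) nu <= e%:E)%E.

Section AmenableReiter.
Variable A : groupType.
Local Notation V := (A -> A -> R).

(** Elements of [V] are families of functions on [A] indexed by [A]; in [D] all members are in
    l^1(A), and [N] below adds the l^1 norms of those indexed by [K]. *)
Let D : set V := [set v | forall k, (sumT (fun y => `|v k y|%R) < +oo)%E].

Let D0 : D 0.
Proof. by move=> k; rewrite /sumT esum1 ?ltry// => t _; rewrite normr0. Qed.

Let normD (f g : A -> R) :
  (sumT (fun y => `|f y + g y|%R) <=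
   sumT (fun y => `|f y|%R) + sumT (fun y => `|g y|%R))%E.
Proof. by rewrite -sumTD//; apply: le_sumT => t; exact: ler_normD. Qed.

Let DD v w : D v -> D w -> D (v + w).
Proof.
by move=> Dv Dw k; apply: le_lt_trans (normD _ _) _; exact: lte_add_pinfty.
Qed.

Let normZ t (f : A -> R) :
  sumT (fun y => `|t * f y|%R) = (`|t|%:E * sumT (fun y => `|f y|%R))%E.
Proof. by rewrite -sumTZ//; apply: eq_sumT => y; rewrite normrM. Qed.

Let DZ t v : D v -> D (t *: v).
Proof.
by move=> Dv k; rewrite (normZ t (v k)) lte_mul_pinfty// lee_fin.
Qed.

Variable K : seq A.
Hypothesis uK : uniq K.

Let N (v : V) : R := \sum_(k <- K) fine (sumT (fun y => `|v k y|)).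

Let fin v k : D v -> sumT (fun y => `|v k y|) \is a fin_num.
Proof. by move=> Dv; rewrite ge0_fin_numE ?Dv// sumT_ge0. Qed.

Let sN : sublinear D N.
Proof.
split=> [v w Dv Dw|t v t0 Dv].
  rewrite /N -big_split/=; apply: ler_sum => k _.
  rewrite -fineD ?fin// fine_le ?fin_numD ?fin//; last exact: normD.
  exact: DD.
rewrite /N mulr_sumr; apply: ler_sum => k _.
rewrite (normZ t (v k)) fineM ?fin//=.
by rewrite ger0_norm.
Qed.

Let c (u : A -> R) : V :=
  fun k y => if k \in K then u (k^-1 * y)%g - u y else 0.

Let summ (u : A -> R) := (forall y, 0 <= u y) /\ (sumT u < +oo)%E.

Let Dc u : summ u -> D (c u).
Proof.
move=> [u0 su] k.
apply: (@le_lt_trans _ _ (sumT (fun y => u (k^-1 * y)%g + u y))).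
  apply: le_sumT => y; rewrite /c; case: ifP => _; last first.
    by rewrite normr0 addr_ge0.
  by rewrite (le_trans (ler_normB _ _))// !ger0_norm.
by rewrite sumTD// -(reindex_sumT u (mulgI_bij _)) lte_add_pinfty.
Qed.

Let addE (v w : V) k y : (v + w) k y = v k y + w k y. Proof. by []. Qed.
Let scaleE t (v : V) k y : (t *: v) k y = t * v k y. Proof. by []. Qed.

Let e k0 y0 : V := fun k y => if (k == k0) && (y == y0) then 1 else 0.

Let sume k0 y0 k : sumT (fun y => `|e k0 y0 k y|) = (k == k0)%:R%:E.
Proof.
rewrite /e; case: eqP => /= _; last first.
  by rewrite /sumT esum1// => y _; rewrite normr0.
rewrite -(@sumT_indicator _ _ y0 1)//; apply: eq_sumT => y.
by case: eqP; rewrite ?normr1 ?normr0.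
Qed.

Let De k y : D (e k y). Proof. by move=> k'; rewrite sume ltry. Qed.

Let Ne k y : N (e k y) <= (size K)%:R.
Proof.
rewrite /N -sum1_size natr_sum; apply: ler_sum => k' _; rewrite sume /=.
by case: eqP.
Qed.

Let delta (x : A) : A -> R := fun y => if y == x then 1 else 0.

Let c_delta x : c (delta x) = \sum_(k <- K) (e k (k * x)%g - e k x).
Proof.
rewrite fct_sumE; apply/funext => k; rewrite fct_sumE; apply/funext => y.
rewrite /c; case: ifP => [kK|kK]; last first.
  rewrite big_seq big1// => k' k'K; rewrite /e.
  rewrite [LHS]/(_ - _) (_ : (k == k') = false); first exact: (subrr (0 : R)).
  by apply/eqP => kk'; rewrite kk' k'K in kK.
rewrite (bigD1_seq k)//= big1 ?addr0.
  rewrite [RHS]/(_ - _) /e eqxx /= /delta.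
  suff -> : (k^-1 * y == x)%g = (y == k * x)%g by [].
  by apply/eqP/eqP => [<-|->]; rewrite ?mulVKg ?mulKg.
move=> k' k'k; rewrite [LHS]/(_ - _) /e (_ : (k == k') = false).
  exact: (subrr (0 : R)).
by rewrite eq_sym; apply/negbTE.
Qed.

Let additive_sum (l : V -> R) (f : A -> V) (s : seq A) :
  (forall v w, D v -> D w -> l (v + w) = l v + l w) ->
  (forall k, D (f k)) -> D (\sum_(k <- s) f k) /\
    l (\sum_(k <- s) f k) = \sum_(k <- s) l (f k).
Proof.
move=> lD Df; elim: s => [|k s [IHD IH]].
  by rewrite !big_nil; split=> //; have := lD _ _ D0 D0; rewrite addr0; lra.
by rewrite !big_cons; split; [exact: DD|rewrite lD// IH].
Qed.

(* Day's argument: if no probability measure were almost invariant, a bounded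
   functional [l] would separate the differences [k u - u], [k \in K], from 0;
   restricted to point masses it provides bounded functions [phi k] with
   [\sum_k (phi k (k x) - phi k x) >= d] for all [x], against the mean. *)
Lemma amenable_almost_invariant (d : R) : 0 < d -> amenable R A ->
  exists nu : Prob R A, forall k, k \in K ->
      (l1dist (translate k nu) nu <= d%:E)%E.
Proof.
move=> d0 [m mean_m]; apply: contrapT => H.
pose Q (v : V) (mu : R) := exists u, [/\ summ u, v = c u & mu = d * fine (sumT u)].
have finu u : summ u -> sumT u \is a fin_num.
  by move=> [u0 su]; rewrite ge0_fin_numE// sumT_ge0.
have [|v w mu nu|t v mu t0|v mu|l [lD lN lQ]] := @cone_separation _ _ D D0 DD DZ N Q sN.
- exists (fun=> 0); have s0 : sumT (fun _ : A => 0 : R) = 0%E by rewrite /sumT esum1.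
  split; first by split=> //; rewrite s0 ltry.
    by apply/funext => k; apply/funext => y; rewrite /c; case: ifP; rewrite ?subrr.
  by rewrite s0 mulr0.
- move=> [u [su -> ->]] [u' [su' -> ->]]; exists (fun y => u y + u' y).
  have [[u0 fu] [u'0 fu']] := (su, su'); split.
  + split; first by move=> y; exact: addr_ge0.
    by rewrite sumTD// lte_add_pinfty.
  + apply/funext => k; apply/funext => y; rewrite addE /c.
    by case: ifP => _; ring.
  + by rewrite sumTD// fineD ?finu// mulrDr.
- move=> [u [su -> ->]]; exists (fun y => t * u y).
  have [u0 fu] := su; split.
  + split; first by move=> y; exact: mulr_ge0.
    by rewrite sumTZ// lte_mul_pinfty// lee_fin.
  + apply/funext => k; apply/funext => y; rewrite scaleE /c.
    by case: ifP => _; ring.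
  + by rewrite sumTZ// fineM ?finu//=; ring.
(* By the negated conclusion some [k \in K] moves the normalized [u] by more than [d], whence
   [d * fine (sumT u) <= N (c u)]. *)
- move=> [u [su -> ->]]; split; first exact: Dc.
  have [u0 fu] := su.
  have N0 : 0 <= N (c u) by apply: sumr_ge0 => k _; apply: fine_ge0; exact: sumT_ge0.
  have : 0 <= fine (sumT u) by rewrite fine_ge0// sumT_ge0.
  rewrite le_eqVlt => /predU1P[<-|W0]; first by rewrite mulr0.
  have uW : sumT u = (fine (sumT u))%:E by rewrite fineK// finu.
  have /existsNP[k] : ~ forall k, k \in K ->
      (l1dist (translate k (normalize u0 uW W0)) (normalize u0 uW W0) <= d%:E)%E.
    by move=> HK; apply: H; exists (normalize u0 uW W0).
  move=> /not_implyP[kK /negP]; rewrite -ltNge => dk.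
  apply: (@le_trans _ _ (fine (sumT (fun y => `|c u k y|)))); last first.
    rewrite /N (bigD1_seq k)//= lerDl; apply: sumr_ge0 => k' _.
    by apply: fine_ge0; exact: sumT_ge0.
  rewrite mulrC -ler_pdivlMl// -lee_fin; apply: le_trans (ltW dk) _.
  rewrite EFinM fineK ?fin//; last exact: Dc.
  rewrite -sumTZ ?invr_ge0 ?(ltW W0)// l1distE; apply: le_sumT => y.
  by rewrite /translate /= -mulrBr normrM gtr0_norm ?invr_gt0// /c kK.
pose phi k y := l (e k y).
have lN' v : D v -> - l v <= N (- v).
  move=> Dv; have Dv' : D (- v) by rewrite -scaleN1r; exact: DZ.
  apply: le_trans (lN _ Dv').
  have l0 : l 0 = 0 by have := lD _ _ D0 D0; rewrite addr0; lra.
  by have := lD _ _ Dv Dv'; rewrite subrr l0; lra.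
have NN v : N (- v) = N v.
  by apply: eq_bigr => k _; congr fine; apply: eq_sumT => y; rewrite normrN.
have bphi k : bounded_function (phi k).
  exists (size K)%:R => y; rewrite ler_norml lerNl.
  rewrite (le_trans (lN' _ (De _ _)))/= ?NN ?Ne//.
  exact: le_trans (lN _ (De _ _)) (Ne _ _).
have bphi' k : bounded_function (fun y => phi k (k * y)%g).
  by have [M HM] := bphi k; exists M.
have bB k : bounded_function (fun x => phi k (k * x)%g - phi k x).
  by apply: bounded_functionD => //; exact: bounded_functionN.
have : m (fun x => \sum_(k <- K) (phi k (k * x)%g - phi k x)) = 0.
  rewrite (mean_sum mean_m)// big1// => k _.
  by rewrite (meanB mean_m)// (mean_translate mean_m)// subrr.
suff : d <= m (fun x => \sum_(k <- K) (phi k (k * x)%g - phi k x)).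
  by move=> /[swap] ->; lra.
rewrite -[leLHS](mean_cst mean_m); apply: (le_mean mean_m).
- exact: bounded_function_cst.
- exact: bounded_function_sum.
move=> x; have : Q (c (delta x)) d.
  exists (delta x).
  have sd : sumT (delta x) = 1%E by exact: sumT_indicator.
  split=> //; last by rewrite sd mulr1.
  by split; [move=> y; rewrite /delta; case: ifP|rewrite sd ltry].
move=> /lQ; rewrite c_delta.
have De' k : D (e k (k * x)%g - e k x).
  by apply: DD; [exact: De|rewrite -scaleN1r; exact/DZ/De].
rewrite (additive_sum K lD De').2 => /le_trans; apply; apply: ler_sum => k _.
have := lD _ _ (De' k) (De k x); rewrite subrK /phi => ->.
by rewrite addrK.
Qed.

End AmenableReiter.

Lemma amenable_reiter (A : groupType) : amenable R A -> reiter A.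
Proof.
move=> aA K d d0.
have [nu Hnu] := amenable_almost_invariant (undup_uniq K) d0 aA.
by exists nu => k kK; apply: Hnu; rewrite mem_undup.
Qed.

End Reiter.

Section MoreProb.
Variable R : realType.

Lemma bind_neq0 (T U : choiceType) (p : Prob R T) (q : T -> Prob R U) u :
  bind p q u != 0 -> exists t, p t != 0 /\ q t u != 0.
Proof.
apply: contra_neqP => H; rewrite bindE /sumT esum1// => t _; congr EFin.
apply/eqP; rewrite mulf_eq0; apply/negPn/negP; rewrite negb_or => /andP tt.
by apply: H; exists t.
Qed.

Variable G : groupType.

Lemma translateM (k h : G) (f : G -> R) :
  translate k (translate h f) = translate (k * h)%g f.
Proof. by apply/funext => x; rewrite /translate invgM mulgA. Qed.

Lemma translate1 (f : G -> R) : translate 1%g f = f.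
Proof. by apply/funext => x; rewrite /translate invg1 mul1g. Qed.

Lemma l1dist_shift (k : G) (f h : G -> R) :
  l1dist (fun t => f (k * t)%g) h = l1dist f (translate k h).
Proof.
rewrite -(l1dist_reindex f (translate k h) (mulgI_bij k)).
by congr l1dist; apply/funext => x; rewrite /translate mulKg.
Qed.

End MoreProb.

(** * Almost invariant measures on direct sums *)

Section DirectSumReiter.
Variables (R : realType) (I : choiceType) (A : groupType).
Local Notation N := (direct_sum I A).

Lemma dsum_single_subproof (i : I) (a : A) :
  finsupp_pred (fun j => if j == i then a else 1%g).
Proof.
apply/asboolP; apply: (@sub_finite_set _ _ [set i]); last exact: finite_set1.
by move=> j /=; case: eqP.
Qed.

Definition dsum_single (i : I) (a : A) : N := Sub _ (dsum_single_subproof i a).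

Lemma dsum_singleE i a j : val (dsum_single i a) j = if j == i then a else 1%g.
Proof. by []. Qed.

Lemma val_dsumM (f g : N) j : val (f * g)%g j = (val f j * val g j)%g.
Proof. by []. Qed.

Lemma val_dsumV (f : N) j : val (f^-1)%g j = (val f j)^-1%g.
Proof. by []. Qed.

Lemma val_dsum1 j : val (1%g : N) j = 1%g.
Proof. by []. Qed.

Lemma dsum_ext (f g : N) : (forall j, val f j = val g j) -> f = g.
Proof. by move=> fg; apply/val_inj/funext. Qed.

Lemma dsum_singleM i a b :
  dsum_single i (a * b)%g = (dsum_single i a * dsum_single i b)%g.
Proof.
by apply: dsum_ext => j; rewrite val_dsumM !dsum_singleE; case: eqP; rewrite ?mulg1.
Qed.

Definition dsum_drop (i : I) (f : N) : N := ((dsum_single i (val f i))^-1 * f)%g.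

Lemma dsum_dropE i f j : val (dsum_drop i f) j = if j == i then 1%g else val f j.
Proof.
rewrite val_dsumM val_dsumV dsum_singleE; case: eqP => [->|_].
  by rewrite mulVg.
by rewrite invg1 mul1g.
Qed.

Lemma dsum_dropK i f : (dsum_single i (val f i) * dsum_drop i f)%g = f.
Proof. by rewrite mulVKg. Qed.

Lemma dsum_drop_commute i f a :
  (dsum_drop i f * dsum_single i a = dsum_single i a * dsum_drop i f)%g.
Proof.
apply: dsum_ext => j; rewrite (val_dsumM (dsum_drop i f)).
rewrite (val_dsumM (dsum_single i a)) dsum_dropE dsum_singleE.
by case: eqP; rewrite ?(mul1g, mulg1).
Qed.

(* [nu] is the convolution of almost invariant measures on the factors [i \in J];
   distinct factors commute. *)
Lemma reiter_dsum_seq (J : seq I) (F : seq N) (e : R) : 0 < e -> reiter R A ->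
  exists nu : Prob R N, forall f : N, f \in F ->
    (forall i, i \notin J -> val f i = 1%g) ->
    (l1dist (translate f nu) nu <= ((size J)%:R * e)%:E)%E.
Proof.
move=> e0 rA; elim: J F => [|i J IH] F.
  exists (dirac_prob R (1 : N)%g) => f _ f1.
  rewrite (_ : f = 1%g); last by apply: dsum_ext => j; exact: f1.
  by rewrite translate1 l1distxx mul0r.
have [nuA HA] := rA [seq val f i | f : N <- F] _ e0.
have [nu' Hnu] := IH [seq dsum_drop i f | f : N <- F].
exists (bind nuA (fun a => ptranslate (dsum_single i a) nu')) => f fF f1.
rewrite l1dist_sym.
apply: (@l1dist_bind_translate_le _ _ _ (fun a => val f i * a)%g _ _ _ _ e
    ((size J)%:R * e)).
- exact: mulgI_bij.
(* With [f'] the part of [f] off [i], the product of [f] and [t] in the factor [i] is [val f i * t]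
   in that factor times [f']; the induction hypothesis bounds the effect of [f'] on [nu']. *)
- move=> t _; rewrite -[X in translate f X]/(translate _ nu') translateM.
  rewrite -[X in l1dist X]/(translate (dsum_single i (val f i * t)%g) nu').
  rewrite -[in (f * _)%g](dsum_dropK i f) -mulgA dsum_drop_commute mulgA -dsum_singleM.
  rewrite -translateM l1dist_translate l1dist_sym; apply: Hnu.
    exact: map_f.
  move=> j jJ; rewrite dsum_dropE; case: eqP => // /eqP ji.
  by apply: f1; rewrite inE negb_or ji.
- by rewrite l1dist_shift l1dist_sym; apply: HA; exact: (map_f (fun f : N => val f i)).
- by rewrite mulr_ge0// ltW.
- by rewrite /= -addn1 natrD mulrDl mul1r addrC.
Qed.

(** The elements of the finite list [K] are supported in a common finite [J], among whose factors
    the tolerance is divided; the successor in the divisor covers an empty [J]. *)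
Lemma reiter_dsum : reiter R A -> reiter R N.
Proof.
move=> rA K e e0.
have [J HJ] : exists J : seq I, forall f : N, f \in K ->
    forall i, i \notin J -> val f i = 1%g.
  elim: K => [|f K [J HJ]]; first by exists [::].
  have /asboolP/finite_seqP[s sE] := valP f.
  exists (s ++ J) => g.
  rewrite inE => /predU1P[->|gK] i; rewrite mem_cat negb_or => /andP[iX iJ].
    apply: contrapT => fi; move/negP: iX; apply.
    by have : [set i | val f i <> 1%g] i by []; rewrite sE.
  exact: HJ.
have [] := @reiter_dsum_seq J K (e / (size J).+1%:R) _ rA.
  by rewrite divr_gt0.
move=> nu Hnu; exists nu => f fK.
apply: le_trans (Hnu _ fK (HJ _ fK)) _.
rewrite lee_fin mulrCA; apply: ler_piMr; first exact: ltW.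
rewrite ler_pdivrMr// mul1r ler_nat.
exact: leqnSn.
Qed.

End DirectSumReiter.

(** * Exactness *)

Section Tightness.
Variable R : realType.

Lemma Prob_finite_approx (T : choiceType) (p : Prob R T) (d : R) : 0 < d ->
  exists2 s : seq T, uniq s & 1 - d < \sum_(t <- s) p t.
Proof.
move=> d0; apply: contrapT => H.
have : (sumT p <= (1 - d)%:E)%E.
  apply: ge_sumT => s us; rewrite lee_fin leNgt; apply/negP => sd.
  by apply: H; exists s.
by rewrite sumT_pmass lee_fin; lra.
Qed.

(** A Dini argument: finite partial sums are continuous and increase with the finite set, so a set
    good at [x] is good near [x], as is every larger one. Compactness is used along the filter of
    finite lists ordered by inclusion. *)
Lemma tight_family (X : topologicalType) (T : choiceType) (mu : X -> Prob R T)
    (d : R) :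
  compact [set: X] -> (forall t, continuous (fun x => mu x t)) -> 0 < d ->
  exists2 s : seq T, uniq s & forall x, 1 - d <= \sum_(t <- s) mu x t.
Proof.
move=> /compact_near_coveringP cX cmu d0.
pose F : set_system (seq T) :=
  filter_from [set: seq T] (fun s => [set s' : seq T | {subset s <= s'}]).
have FF : Filter F.
  apply: filter_from_filter; first by exists [::].
  move=> s1 s2 _ _; exists (s1 ++ s2) => // s' ss'.
  by split=> t ts; apply: ss'; rewrite mem_cat ts ?orbT.
pose P s x := 1 - d <= \sum_(t <- undup s) mu x t.
have := cX _ F P FF; case.
  move=> x _; have [s us sd] := Prob_finite_approx (mu x) d0.
  have cs : continuous (fun x' => \sum_(t <- s) mu x' t).
    elim: s {us sd} => [|t s IH].
      rewrite (_ : (fun _ => _) = (fun=> 0)); first exact: cst_continuous.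
      by apply/funext => y; rewrite big_nil.
    rewrite (_ : (fun _ => _) = (fun y => mu y t + \sum_(t <- s) mu y t)).
      by move=> y; apply: continuousD; [exact: cmu|exact: IH].
    by apply/funext => y; rewrite big_cons.
  exists ([set x' | 1 - d < \sum_(t <- s) mu x' t], [set s' : seq T | {subset s <= s'}]).
    split; last by exists s.
    have := @cvgr_gt _ _ _ _ _ _ (cs x) _ sd; exact.
  move=> [x' s'] [/= x's ss']; rewrite /P.
  apply: le_trans (ltW x's) _.
  rewrite [leRHS](bigID (mem s))/= -[leLHS]addr0 lerD//.
    rewrite -[leRHS]big_filter le_eqVlt; apply/orP; left; apply/eqP/perm_big.
    rewrite perm_sym; apply: uniq_perm; rewrite ?filter_uniq ?undup_uniq// => t.
    by rewrite mem_filter mem_undup; have := ss' t; case: (t \in s) => // ->.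
  by apply: sumr_ge0 => t _; exact: pmass_ge0.
move=> s _ /(_ s (fun t => id)) H; exists (undup s); first exact: undup_uniq.
by move=> x; apply: (H x).
Qed.

(** Serves estimates known only on the finite set [s]: off [s], of mass at most [d], the trivial
    bound 2 on l^1 distances is used. *)
Lemma sumT_tail (T : choiceType) (p : Prob R T) (s : seq T) (c d : R) :
  0 <= c -> uniq s -> 1 - d <= \sum_(t <- s) p t ->
  (sumT (fun t => p t * (if t \in s then c else 2))%R <= (c + 2 * d)%:E)%E.
Proof.
move=> c0 us sd.
set f := (X in sumT X); pose g t := if t \in s then p t else 0.
have p0 := pmass_ge0 p.
have f0 t : 0 <= f t by rewrite /f mulr_ge0//; case: ifP.
have g0 t : 0 <= g t by rewrite /g; case: ifP.
have : (sumT (fun t => f t + 2 * g t)%R <= sumT (fun t => (c + 2) * p t)%R)%E.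
  apply: le_sumT => t; rewrite /f /g; have := p0 t.
  by case: ifP => _ *; nra.
rewrite sumTD//; last by move=> t; rewrite mulr_ge0.
rewrite !sumTZ// ?addr_ge0// sumT_pmass mule1.
have : ((1 - d)%:E <= sumT g)%E.
  apply: le_trans (sum_le_sumT g us); rewrite lee_fin (le_trans sd)//.
  by rewrite big_seq [leRHS]big_seq; apply: ler_sum => t ts; rewrite /g ts.
have : (sumT g <= 1)%E.
  rewrite -(sumT_pmass p); apply: le_sumT => t; rewrite /g.
  by case: ifP => // _; exact: p0.
have : (0 <= sumT f)%E by exact: sumT_ge0.
have : (0 <= sumT g)%E by exact: sumT_ge0.
case: (sumT f) (sumT g) => [a| |] [b| |] //; rewrite ?leye_eq//.
by rewrite -EFinM -EFinD !lee_fin => *; lra.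
Qed.

Lemma countable_exhaustion (G : choiceType) : countable [set: G] ->
  exists K : nat -> seq G,
    (forall m n, (m <= n)%N -> {subset K m <= K n}) /\
    (forall g, exists n, g \in K n).
Proof.
move=> /countable_injP[f finj].
have [h Hh] : {h : nat -> option G & forall n g, f g = n -> h n = Some g}.
  apply: (@choice _ _ (fun n y => forall g, f g = n -> y = Some g)) => n.
  have [[g gn]|ng] := pselect (exists g, f g = n).
    exists (Some g) => g' hn; congr Some; apply: finj; rewrite ?inE//.
    by rewrite gn hn.
  by exists None => g gn; exfalso; apply: ng; exists g.
exists (fun n => pmap h (iota 0 n)); split.
  move=> m n mn g; rewrite !mem_pmap => /mapP[i + ->].
  rewrite mem_iota => /andP[_ im]; apply: map_f; rewrite mem_iota.
  exact: leq_trans im mn.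
move=> g; exists (f g).+1; rewrite mem_pmap -(Hh _ _ (erefl (f g))).
by apply: map_f; rewrite mem_iota leq0n add0n ltnS leqnn.
Qed.

Lemma ge0_cvge0P (T : Type) (F : set_system T) (FF : Filter F)
    (f : T -> \bar R) : (forall x, (0 <= f x)%E) ->
  f x @[x --> F] --> 0%E <->
  forall e : R, 0 < e -> \forall x \near F, (f x <= e%:E)%E.
Proof.
move=> f0; split=> [cF e e0|H].
  have : \forall x \near F, (f x < e%:E)%E.
    exact: (cF _ (@nbhs_open_ereal_lt R 0 (fun=> e) e0)).
  by apply: filterS => x; exact: ltW.
apply/fine_cvgP; split.
  have := H 1 ltr01; apply: filterS => x Hx; rewrite ge0_fin_numE//.
  by apply: (le_lt_trans Hx); rewrite ltry.
apply/cvgr0Pnorm_le => e e0; have := H e e0; apply: filterS => x Hx.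
rewrite ger0_norm ?fine_ge0// -lee_fin.
by rewrite fineK// ge0_fin_numE// (le_lt_trans Hx)// ltry.
Qed.

(** Turns the supremum in [amenable_action] into uniform smallness; a point of [T] makes the suprema
    nonnegative. *)
Lemma ereal_sup_cvg0P (T : Type) (F : nat -> T -> \bar R) :
  (forall n x, (0 <= F n x)%E) -> [set: T] !=set0 ->
  ereal_sup (range (F n)) @[n --> \oo] --> 0%E <->
  forall e : R, 0 < e -> \forall n \near \oo, forall x, (F n x <= e%:E)%E.
Proof.
move=> F0 [x0 _]; have S0 n : (0 <= ereal_sup (range (F n)))%E.
  by apply: le_trans (F0 n x0) _; apply: ereal_sup_ubound; exists x0.
rewrite ge0_cvge0P//; split=> H e e0; have := H e e0; apply: filterS => n Hn.
  by move=> x; apply: le_trans Hn; apply: ereal_sup_ubound; exists x.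
by apply: ge_ereal_sup => _ [x _ <-]; exact: Hn.
Qed.

End Tightness.

Section Multiplicative.
Variables (G H : groupType) (f : {multiplicative G -> H}).

Lemma multiplicative1 : f 1%g = 1%g.
Proof. by apply: (mulgI (f 1%g)); rewrite -gmulfM !mulg1. Qed.

Lemma multiplicativeV x : f (x^-1)%g = (f x)^-1%g.
Proof. by apply: (mulgI (f x)); rewrite -gmulfM !mulgV multiplicative1. Qed.

End Multiplicative.

(** * Lifting measures through a group extension *)

Section Extension.
Variables (R : realType) (N G B : groupType).
Variables (iota : {multiplicative N -> G}) (eps : {multiplicative G -> B}).
Hypotheses (ker_eps : range iota = eps @^-1` [set 1%g])
  (eps_surj : range eps = [set: B]).

Lemma eps_section : exists s : B -> G, forall b, eps (s b) = b.
Proof.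
have [s Hs] : {s : B -> G & forall b, eps (s b) = b}.
  apply: (@choice _ _ (fun b g => eps g = b)) => b; have : [set: B] b by [].
  by rewrite -eps_surj => -[g _ <-]; exists g.
by exists s.
Qed.

Lemma eps_iota n : eps (iota n) = 1%g.
Proof.
have : range iota (iota n) by exists n.
by rewrite ker_eps.
Qed.

Lemma ker_epsP g : eps g = 1%g -> exists n, g = iota n.
Proof.
move=> g1; have : (eps @^-1` [set 1%g]) g by [].
by rewrite -ker_eps => -[n _ <-]; exists n.
Qed.

Variables (X : topologicalType) (act : left_action B X).
Hypothesis cX : compact [set: X].

(* The fibre of [eps] over [b] carries the translate by a lift of [b] of an
   almost invariant measure on the kernel; measures on [B] lift accordingly. *)
Lemma equivariant_lift (mu : X -> Prob R B) (K : seq G) (e : R) :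
  0 < e -> reiter R N ->
  (forall b, continuous (fun x => mu x b)) ->
  (forall k x, k \in K ->
    (l1dist (mu (act (eps k) x)) (translate (eps k) (mu x)) <= e%:E)%E) ->
  exists mu' : X -> Prob R G,
    (forall g, continuous (fun x => mu' x g)) /\
    (forall k x, k \in K ->
      (l1dist (mu' (act (eps k) x)) (translate k (mu' x)) <= (4 * e)%:E)%E).
Proof.
move=> e0 rN cmu muK.
have [s sP] := eps_section.
have [S uS HS] := tight_family cX cmu e0.
(* The cocycle of the section [s]. Its values on [K] times the finite set [S] are the elements under
   which [nu] has to be almost invariant. *)
have [c Hc] : {c : G * B -> N & forall kb,
    (kb.1 * s kb.2 = s (eps kb.1 * kb.2) * iota (c kb))%g}.
  apply: (@choice _ _ (fun kb n =>
    (kb.1 * s kb.2 = s (eps kb.1 * kb.2) * iota n)%g)) => -[k b] /=.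
  have [|n nE] := @ker_epsP ((s (eps k * b))^-1 * (k * s b))%g.
    by rewrite gmulfM multiplicativeV gmulfM !sP mulVg.
  by exists n; rewrite -nE mulVKg.
have [nu Hnu] := rN [seq c (k, b) | k <- K, b <- S] e e0.
pose q b := bind nu (fun n => dirac_prob R (s b * iota n)%g).
have q0 b g : eps g != b -> q b g = 0.
  move=> gb; apply/eqP/negPn/negP => /bind_neq0[n [_]] /=.
  case: (g =P _) => [gE _|_]; last by rewrite eqxx.
  by move: gb; rewrite gE gmulfM sP eps_iota mulg1 eqxx.
(* Since [q b] lives on the fibre over [b], one term of the sum survives; this makes the lift
   continuous in [x]. *)
have bqE x g : bind (mu x) q g = mu x (eps g) * q (eps g) g.
  rewrite bindE (eq_sumT (g := fun b =>
    if b == eps g then mu x (eps g) * q (eps g) g else 0)).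
    by rewrite sumT_indicator// mulr_ge0 ?pmass_ge0.
  by move=> b; case: eqP => [->//|/eqP bg]; rewrite q0 ?mulr0// eq_sym.
exists (fun x => bind (mu x) q); split.
  move=> g; under eq_fun do rewrite bqE.
  by move=> x; apply: cvgMl; exact: cmu.
move=> k x kK.
apply: le_trans (@l1dist_bind_translate R G B (fun b => eps k * b)%g _ _ _ _
  (fun b => if b \in S then e else 2) _ _ _) _.
- exact: mulgI_bij.
- by move=> b; case: ifP => // _; exact: ltW.
- move=> b _; case: ifP => bS; last exact: (l1dist_le2 _ (ptranslate k (q b))).
  rewrite -[translate k _]/(pmass (ptranslate k (q b))) ptranslate_bind.
  have -> : bind nu (fun n => ptranslate k (dirac_prob R (s b * iota n)%g)) =
      bind nu (fun n => dirac_prob R (s (eps k * b) * iota (c (k, b) * n))%g).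
    congr bind; apply/funext => n; apply: Prob_ext => g /=.
    rewrite gmulfM mulgA -(Hc (k, b)) /= -mulgA.
    have -> : (k^-1 * g == s b * iota n)%g = (g == k * (s b * iota n))%g; last by [].
    by apply/eqP/eqP => [<-|->]; rewrite ?mulVKg ?mulKg.
  rewrite l1dist_sym -(bind_precomp (mulgI_bij (c (k, b))^-1%g)).
  under [X in bind _ X]eq_fun do rewrite mulVKg.
  apply: (@l1dist_bind_le _ _ _ _ _ _ _ e 0).
  + by move=> n _; rewrite l1distxx.
  + by apply: Hnu; exact: allpairs_f.
  + by [].
  + by rewrite addr0.
(* The total [4 * e] consists of [e] from [mu], [e] from the fibres over [S], and [2 * e] from the
   fibres off [S]. *)
rewrite l1dist_shift; apply: le_trans (leeD (muK _ x kK) (sumT_tail _ _ (HS x))) _ => //.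
  exact: ltW.
by rewrite -EFinD lee_fin; lra.
Qed.

End Extension.

(** * Orbit representatives and averages over stabilizers *)

Section OrbitRepresentatives.
Variables (G : groupType) (I : Type) (act : left_action G I).

Lemma lactVK g : cancel (act g) (act g^-1%g).
Proof. by move=> i; rewrite -lactM mulVg lact1. Qed.

Lemma lactKV g : cancel (act g^-1%g) (act g).
Proof. by move=> i; rewrite -lactM mulgV lact1. Qed.

Lemma lact_bij g : bijective (act g).
Proof. by exists (act g^-1%g); [exact: lactVK|exact: lactKV]. Qed.

(** A choice function on subsets of [I] is applied to the orbit as a set, hence returns the same
    point throughout an orbit. *)
Lemma orbit_representative : exists (r : I -> I) (t : I -> G),
  (forall i, act (t i) (r i) = i) /\ (forall g i, r (act g i) = r i).
Proof.
have [c Hc] : {c : set I -> option I &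
    forall P, P !=set0 -> exists2 j, c P = Some j & P j}.
  apply: (@choice _ _ (fun P o => P !=set0 -> exists2 j, o = Some j & P j)) => P.
  have [[j Pj]|P0] := pselect (P !=set0); first by exists (Some j) => _; exists j.
  by exists None.
pose orb i := [set j | exists g, act g i = j].
have orbM g i : orb (act g i) = orb i.
  apply/seteqP; split=> j [h <-].
    by exists (h * g)%g; rewrite lactM.
  by exists (h * g^-1)%g; rewrite lactM lactVK.
pose r i := odflt i (c (orb i)).
have orb0 i : orb i !=set0 by exists i; exists 1%g; rewrite lact1.
have [t Ht] : {t : I -> G & forall i, act (t i) (r i) = i}.
  apply: (@choice _ _ (fun i g => act g (r i) = i)) => i.
  have [j cj [g gj]] := Hc _ (orb0 i).
  by exists g^-1%g; rewrite /r cj /= -gj lactVK.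
exists r, t; split=> // g i; rewrite /r orbM.
by have [j -> _] := Hc _ (orb0 i).
Qed.

End OrbitRepresentatives.

Section StabilizerAverage.
Variables (R : realType) (B G : groupType) (eps : {multiplicative G -> B}).
Variables (I : Type) (actI : left_action B I).
Variables (X : Type) (actX : left_action B X) (x0 : X).
Variable mu : X -> Prob R G.
Hypothesis mu_tight : forall d : R, 0 < d ->
  exists2 s : seq G, uniq s & forall x, 1 - d <= \sum_(g <- s) mu x g.

Section Average.
Variables (j : I) (m : (stabilizer actI j -> R) -> R).
Hypothesis mean_m : invariant_mean m.

Let f (b : B) (g : G) : stabilizer actI j -> R :=
  fun l => mu (actX (b * val l)%g x0) g.

Let bf b g : bounded_function (f b g).
Proof. by exists 1 => l; rewrite ger0_norm ?pmass_ge0 ?pmass_le1. Qed.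

Definition stab_average (b : B) (g : G) : R := m (f b g).

Let sum_average b (s : seq G) :
  \sum_(g <- s) stab_average b g =
  m (fun l => \sum_(g <- s) mu (actX (b * val l)%g x0) g).
Proof. exact: esym (mean_sum mean_m s (bf b)). Qed.

Lemma stab_average_ge0 b g : 0 <= stab_average b g.
Proof.
rewrite -(mean_cst mean_m 0); apply: (le_mean mean_m) => //.
  exact: bounded_function_cst.
by move=> l; exact: pmass_ge0.
Qed.

(** A mean is only finitely additive, so mass could escape; uniform tightness keeps mass [1 - d] on
    one finite set, where [m] commutes with the sum. *)
Lemma stab_average_sum1 b :
  (\esum_(g in [set: G]) (stab_average b g)%:E = 1)%E.
Proof.
have bs (s : seq G) : bounded_function
    (fun l : stabilizer actI j => \sum_(g <- s) mu (actX (b * val l)%g x0) g).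
  exact: (@bounded_function_sum _ _ _ s (f b)).
apply/eqP; rewrite eq_le; apply/andP; split.
  apply: ge_sumT => s us; rewrite lee_fin sum_average -(mean_cst mean_m 1).
  apply: (le_mean mean_m) => //; first exact: bounded_function_cst.
  by move=> l; rewrite -lee_fin -(sumT_pmass (mu (actX (b * val l)%g x0))) sum_le_sumT.
apply/lee_addgt0Pr => d d0; have [s us sd] := mu_tight d0.
apply: (@le_trans _ _ ((\sum_(g <- s) stab_average b g)%:E + d%:E)%E).
  rewrite -EFinD lee_fin -lerBlDr sum_average -[leLHS](mean_cst mean_m).
  apply: (le_mean mean_m) => //; first exact: bounded_function_cst.
by rewrite leeD2r// (@sum_le_sumT R _ (stab_average b)).
Qed.

Definition stab_average_prob b := MkProb (stab_average_ge0 b) (stab_average_sum1 b).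

(* By left invariance of [m], the average at [b] only depends on the coset of
   [b], that is, on the point [b j] of the orbit. *)
Lemma stab_average_stab b (l : stabilizer actI j) :
  stab_average_prob (b * val l)%g = stab_average_prob b.
Proof.
apply: Prob_ext => g /=; rewrite /stab_average -(mean_translate mean_m l (bf b g)).
by congr m; apply/funext => l'; rewrite /f -mulgA -valM.
Qed.

(** Test the distance on finite sums, which commute with [m]; under the mean the hypothesis applies
    at each point [actX (b * val l) x0]. *)
Lemma stab_average_translate (k : G) (e : R) b :
  (forall x, (l1dist (mu (actX (eps k) x)) (translate k (mu x)) <= e%:E)%E) ->
  (l1dist (stab_average_prob (eps k * b)%g) (translate k (stab_average_prob b))
   <= e%:E)%E.
Proof.
move=> muk; apply: ge_sumT => s us; rewrite lee_fin.
have bd g : bounded_function (fun l => `|f (eps k * b) g l - f b (k^-1 * g) l|).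
  apply/bounded_function_norm/bounded_functionD => //.
  exact: bounded_functionN.
apply: (@le_trans _ _ (m (fun l => \sum_(g <- s)
    `|f (eps k * b)%g g l - f b (k^-1 * g)%g l|))).
  rewrite (mean_sum mean_m)//; apply: ler_sum => g _.
  exact: (mean_dist mean_m).
rewrite -[leRHS](mean_cst mean_m); apply: (le_mean mean_m).
- exact: bounded_function_sum.
- exact: bounded_function_cst.
move=> l; rewrite -lee_fin; apply: le_trans (muk (actX (b * val l)%g x0)).
rewrite -lactM mulgA.
exact: (@sum_le_sumT R _ (fun g => `|f (eps k * b)%g g l - f b (k^-1 * g)%g l|)).
Qed.

End Average.

Lemma amenable_stabilizer_lift (K : seq G) (e : R) :
  amenable_stabilizers R actI ->
  (forall k x, k \in K ->
    (l1dist (mu (actX (eps k) x)) (translate k (mu x)) <= e%:E)%E) ->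
  exists zeta : I -> Prob R G, forall k i, k \in K ->
    (l1dist (zeta (actI (eps k) i)) (translate k (zeta i)) <= e%:E)%E.
Proof.
move=> amI muK; have [r [t [tr rM]]] := orbit_representative actI.
pose m j := projT1 (cid (amI j)); pose mP j := projT2 (cid (amI j)).
pose z j b := stab_average_prob (mP j) b.
exists (fun i => z (r i) (t i)) => k i kK.
(* Both [eps k * t i] and [t (actI (eps k) i)] carry [r i] to [actI (eps k) i], so they differ by an
   element of the stabilizer of [r i]. *)
have stab_l : stab actI (r i) ((eps k * t i)^-1 * t (actI (eps k) i))%g.
  have kiE : actI (eps k) i = actI (eps k * t i)%g (r i) by rewrite lactM tr.
  by apply/asboolP; rewrite lactM -{1}(rM (eps k) i) tr kiE lactVK.
have := stab_average_stab (mP (r i)) (eps k * t i)%g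
  (Sub _ stab_l : stabilizer actI (r i)).
rewrite SubK mulVKg -/(z _ _) rM => ->.
by apply: stab_average_translate => x; exact: muK.
Qed.

End StabilizerAverage.

Lemma natr_div_le (R : realType) (a e : R) : 0 <= a -> 0 < e ->
  exists M, forall n, (M <= n)%N -> a / n.+1%:R <= e.
Proof.
move=> a0 e0; exists (Num.bound (a / e)) => n Mn.
rewrite ler_pdivrMr// mulrC -ler_pdivrMr//.
apply: le_trans (ltW (archi_boundP _)) _; first by rewrite divr_ge0// ltW.
by rewrite ler_nat; exact: leqW.
Qed.

(** * Exactness of the extension *)

Section ExactExtension.
Variables (R : realType) (N G B : groupType).
Variables (iota : {multiplicative N -> G}) (eps : {multiplicative G -> B}).
Hypotheses (ker_eps : range iota = eps @^-1` [set 1%g])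
  (eps_surj : range eps = [set: B]).

(** Leaves [K] and [e] free and lets [G] act through [eps]: both exactness of [G] and the almost
    equivariant maps into [Prob R G] are drawn from it. *)
Lemma exact_group_lift : exact_group R B -> reiter R N ->
  exists (X : topologicalType) (act : left_action B X),
    [/\ [set: X] !=set0, compact [set: X], hausdorff_space X,
        forall b, continuous (act b) &
        forall (K : seq G) (e : R), 0 < e -> exists mu : X -> Prob R G,
          (forall g, continuous (fun x => mu x g)) /\
          (forall k x, k \in K ->
            (l1dist (mu (act (eps k) x)) (translate k (mu x)) <= e%:E)%E)].
Proof.
move=> [X [act [X0 cX hX [cact [mu [cmu mu0]]]]]] rN.
exists X, act; split=> // K e e0.
(* Lifting multiplies the tolerance by 4. *)
have e40 : 0 < e / 4 by rewrite divr_gt0.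
have : \forall n \near \oo, forall k, k \in K -> forall x,
    (l1dist (mu n (act (eps k) x)) (translate (eps k) (mu n x)) <= (e / 4)%:E)%E.
  elim: K => [|k K IH]; first by near=> n.
  have := (ereal_sup_cvg0P (fun n x => l1dist_ge0 _ _) X0).1 (mu0 (eps k)) _ e40.
  apply: filterS2 IH => n Hn Hk k'; rewrite inE => /predU1P[->//|]; exact: Hn.
move=> [n _ /(_ n (leqnn n)) Hn].
have [mu' [cmu' Hmu']] := equivariant_lift ker_eps eps_surj cX e40 rN (cmu n)
  (fun k x kK => Hn k kK x).
exists mu'; split=> // k x kK; apply: le_trans (Hmu' k x kK) _.
by rewrite lee_fin mulrCA divff// mulr1.
Unshelve. all: by end_near. Qed.

Lemma exact_group_extension : countable [set: G] ->
  exact_group R B -> reiter R N -> exact_group R G.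
Proof.
move=> cG exB rN; have [X [act [X0 cX hX cact Hmu]]] := exact_group_lift exB rN.
have [K [Kmono Kall]] := countable_exhaustion cG.
have act1 x : act (eps 1%g) x = x by rewrite multiplicative1 lact1.
have actM g h x : act (eps (g * h)%g) x = act (eps g) (act (eps h) x).
  by rewrite gmulfM lactM.
exists X, (@LeftAction G X (fun g => act (eps g)) act1 actM).
split=> //; split; first by move=> g; exact: cact.
have [mu Hmu'] : {mu : nat -> X -> Prob R G & forall n,
    (forall g, continuous (fun x => mu n x g)) /\
    (forall k x, k \in K n ->
      (l1dist (mu n (act (eps k) x)) (translate k (mu n x)) <= (n.+1%:R^-1)%:E)%E)}.
  apply: (@choice _ _ (fun n (mu : X -> Prob R G) =>
    (forall g, continuous (fun x => mu x g)) /\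
    (forall k x, k \in K n ->
      (l1dist (mu (act (eps k) x)) (translate k (mu x)) <= (n.+1%:R^-1)%:E)%E))).
  by move=> n; apply: Hmu; rewrite invr_gt0.
exists mu; split; first by move=> n; exact: (Hmu' n).1.
move=> k; apply: (ereal_sup_cvg0P (fun n x => l1dist_ge0 _ _) X0).2 => e e0.
have [n0 kn0] := Kall k.
have [M HM] := natr_div_le ler01 e0.
near=> n => x; apply: le_trans ((Hmu' n).2 k x _) _.
  apply: Kmono kn0; near: n; exact: nbhs_infty_ge.
by rewrite lee_fin -div1r HM//; near: n; exact: nbhs_infty_ge.
Unshelve. all: by end_near. Qed.

End ExactExtension.

(** * From finite tolerance to bi-exactness *)

Section LevelFunction.
Variable G : groupType.
Hypothesis cG : countable [set: G].

(* [L g] is the first [n] with [g \in S n], for finite sets [S n] exhausting [G]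
   such that [S n.+1] contains [E n * S n * E n], where [E n] exhausts [G] too. *)
Lemma level_function (P : nat -> seq G) : exists L : G -> nat,
  [/\ forall n, finite_set [set g | (L g <= n)%N],
      forall k h, exists C, forall g, (L (k * g * h)%g <= L g + C)%N &
      forall n g, g \in P n -> (L g <= n)%N].
Proof.
have [E [Emono Eall]] := countable_exhaustion cG.
pose fix S n : seq G := if n is n'.+1 then
    S n' ++ P n'.+1 ++ E n'.+1 ++
      [seq (kg * h)%g | kg <- [seq (k * g)%g | k <- E n', g <- S n'], h <- E n']
  else P 0%N ++ E 0%N.
have Smono m n : (m <= n)%N -> {subset S m <= S n}.
  move=> /subnK <-; elim: (n - m)%N => [//|d IH] g gS.
  by rewrite addSn /= mem_cat IH.
have PS n : {subset P n <= S n}.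
  by case: n => [|n] g gP; rewrite /= !mem_cat gP ?orbT.
have ES n : {subset E n <= S n}.
  by case: n => [|n] g gP; rewrite /= !mem_cat gP ?orbT.
have Sall g : exists n, g \in S n.
  by have [n gn] := Eall g; exists n; exact: ES.
pose L g := ex_minn (Sall g).
have LS g : g \in S (L g) by rewrite /L; case: ex_minnP.
have Lmin n g : g \in S n -> (L g <= n)%N.
  by rewrite /L; case: ex_minnP => m _ + gn; exact.
exists L; split.
- move=> n; apply: (@sub_finite_set _ _ [set` S n]); last exact: finite_seq.
  by move=> g /= gn; apply: Smono gn _ (LS g).
- move=> k h; have [[m km] [n hn]] := (Eall k, Eall h).
  exists (m + n).+1 => g; apply: Lmin.
  pose q := (L g + (m + n))%N.
  have : (k * g * h)%g \in S q.+1.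
    rewrite /= !mem_cat; apply/orP; right; apply/orP; right; apply/orP; right.
    apply: allpairs_f; first apply: allpairs_f.
    + by apply: Emono km; rewrite /q; lia.
    + by apply: Smono (LS g); rewrite /q; lia.
    + by apply: Emono hn; rewrite /q; lia.
  by rewrite /q addnS.
- by move=> n g gP; apply/Lmin/PS.
Qed.

End LevelFunction.

Lemma finite_family_seq (T U : choiceType) (K : seq T) (P : T -> set U) :
  (forall t, t \in K -> finite_set (P t)) ->
  exists s : seq U, forall t u, t \in K -> P t u -> u \in s.
Proof.
move=> fP; have : finite_set (\bigcup_(t in [set` K]) P t).
  by apply: bigcup_finite; [exact: finite_seq|exact: fP].
move=> /finite_seqP[s sE]; exists s => t u tK Ptu.
have : [set` s] u by rewrite -sE; exists t.
by [].
Qed.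

Section Glue.
Variable R : realType.

Lemma sumT_finite (T : choiceType) (f : T -> R) (s : seq T) :
  (forall t, 0 <= f t) -> uniq s -> (forall t, t \notin s -> f t = 0) ->
  sumT f = (\sum_(t <- s) f t)%:E.
Proof.
move=> f0 us fs; apply/eqP; rewrite eq_le sum_le_sumT// andbT.
apply: ge_sumT => s' us'; rewrite lee_fin.
rewrite (bigID (mem s))/= [X in _ + X]big1 ?addr0; last by move=> t /fs.
rewrite [leRHS](bigID (mem s'))/=.
have -> : \sum_(t <- s' | t \in s) f t = \sum_(t <- s | t \in s') f t.
  rewrite -[LHS]big_filter -[RHS]big_filter; apply: perm_big.
  apply: uniq_perm; rewrite ?filter_uniq// => t.
  by rewrite !mem_filter andbC.
by rewrite lerDl sumr_ge0.
Qed.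

Lemma sumT_interval (a b : nat) :
  sumT (fun j => ((a <= j < b)%N)%:R : R) = ((b - a)%N%:R)%:E.
Proof.
rewrite (@sumT_finite _ _ (iota a (b - a))) ?iota_uniq//; last first.
  by move=> j; rewrite mem_iota; case: (boolP (a <= j < b)%N) => //; lia.
rewrite big_seq (eq_bigr (fun=> 1)); last first.
  by move=> j; rewrite mem_iota => jab; rewrite (_ : (a <= j < b)%N)//; lia.
by rewrite -big_seq big_const_seq count_predT size_iota iter_addr_0.
Qed.

(** The indicators differ only between the two left ends or between the two right ends; truncated
    subtraction encodes the absolute differences. *)
Lemma l1dist_interval (a b a' b' : nat) :
  (l1dist (fun j : nat => ((a <= j < b)%N)%:R : R) (fun j => ((a' <= j < b')%N)%:R)
   <= (((a - a') + (a' - a) + (b - b') + (b' - b))%N%:R)%:E)%E.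
Proof.
rewrite !natrD !EFinD -!sumT_interval -!sumTD//; try by move=> t; rewrite !addr_ge0.
apply: le_sumT => j; rewrite -!natrD.
have : `|((a <= j < b)%N)%:R - ((a' <= j < b')%N)%:R : R| =
    ((a <= j < b)%N != (a' <= j < b')%N)%:R.
  by do 2![case: (_ <= _ < _)%N] => /=;
    rewrite ?subrr ?normr0 ?subr0 ?sub0r ?normrN ?normr1.
move=> ->; rewrite ler_nat.
by lia.
Qed.

Lemma frechet_Filter (T : Type) : Filter (@frechet_filter T).
Proof.
split.
- by rewrite /frechet_filter /= setCT.
- by move=> P Q; rewrite /frechet_filter /= setCI finite_setU.
- by move=> P Q PQ; rewrite /frechet_filter /=; apply/sub_finite_set/subsetC.
Qed.

(* If [F j] is good at tolerance [1 / (j + 1)] for the [j]-th finite set, take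
   for [mu g] the average of the [F j g] with [L g <= j <= 2 L g].  Replacing [g]
   by [k g h] moves this range by O(1) only, and [L] grows so slowly that every
   [F j] involved is good at [g]. *)
Lemma bi_exact_glue (G : groupType) : countable [set: G] ->
  (forall (K : seq G) (e : R), 0 < e -> exists F : G -> Prob R G,
    forall k h, k \in K -> h \in K ->
      finite_set [set g |
        ~ (l1dist (F (k * g * h)%g) (translate k (F g)) <= e%:E)%E]) ->
  exists mu : G -> Prob R G, forall h k : G,
    l1dist (mu (k * g * h)%g) (translate k (mu g))
      @[g --> (@frechet_filter G : set_system G)] --> 0%E.
Proof.
move=> cG H; have [E [Emono Eall]] := countable_exhaustion cG.
have [F HF] : {F : nat -> G -> Prob R G & forall n,
    exists s : seq G, forall k h g, k \in E n -> h \in E n -> g \notin s ->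
    (l1dist (F n (k * g * h)%g) (translate k (F n g)) <= (n.+1%:R^-1)%:E)%E}.
  apply: (@choice _ _ (fun n (F : G -> Prob R G) => exists s : seq G,
    forall k h g, k \in E n -> h \in E n -> g \notin s ->
    (l1dist (F (k * g * h)%g) (translate k (F g)) <= (n.+1%:R^-1)%:E)%E)) => n.
  have n0 : 0 < n.+1%:R^-1 :> R by rewrite invr_gt0.
  have [F HF] := H (E n) _ n0.
  have [|s Hs] := @finite_family_seq _ _ [seq (k, h) | k <- E n, h <- E n]
    (fun kh => [set g | ~ (l1dist (F (kh.1 * g * kh.2)%g)
       (translate kh.1 (F g)) <= (n.+1%:R^-1)%:E)%E]).
    by move=> _ /allpairsP[[k h] [kE hE ->]]; exact: HF.
  exists F, s => k h g kE hE; apply: contraNP => gbad.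
  by apply: (Hs (k, h)) => //; exact: allpairs_f.
have [bad Hbad] := choice HF.
(* If [g] is bad for [j = 2n + 1] or [j = 2n + 2], then [L g <= n], so [j] exceeds [2 * L g]: no
   positive [j] in the averaging range is bad for [g]. *)
have [L [Lfin Ltr Lbad]] :=
  level_function cG (fun n => bad n.*2.+1 ++ bad n.*2.+2).
pose w g (j : nat) : R := ((L g <= j < (L g).*2.+1)%N)%:R.
have w0 g j : 0 <= w g j by [].
have wW g : sumT (w g) = ((L g).+1%:R)%:E.
  by rewrite /w sumT_interval; congr (_%:R)%:E; lia.
have W0 g : 0 < (L g).+1%:R :> R by [].
pose mu g := bind (normalize (w0 g) (wW g) (W0 g)) (fun j => F j g).
exists mu => h k; apply/ge0_cvge0P.
- exact: frechet_Filter.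
- by move=> g; exact: l1dist_ge0.
move=> e e0; rewrite /frechet_filter /prop_near1 /nbhs /=.
have [C LC] : exists C, forall g, (L (k * g * h)%g <= L g + C)%N /\
    (L g <= L (k * g * h)%g + C)%N.
  have [C1 HC1] := Ltr k h; have [C2 HC2] := Ltr k^-1%g h^-1%g.
  exists (C1 + C2)%N => g; split; first by apply: leq_trans (HC1 g) _; lia.
  have := HC2 (k * g * h)%g; rewrite !mulgA mulVg mul1g mulgK => gC.
  by apply: leq_trans gC _; lia.
have [[m km] [n hn]] := (Eall k, Eall h).
(* The left end of the range moves by at most [C] and the right end by at most [2 * C]; normalizing
   doubles the sum, and the tolerance of the [F j] adds 1. *)
have [M eM] := natr_div_le (ler0n R (6 * C + 1)) e0.
apply: sub_finite_set (Lfin (m + n + M + 1)%N) => g /= + ; apply: contraPT.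
rewrite -ltnNge => gL /=; apply.
have [LC1 LC2] := LC g.
apply: (@le_trans _ _ ((6 * C + 1)%N%:R / (L g).+1%:R)%:E); last first.
  by rewrite lee_fin eM//; lia.
change (l1dist (mu (k * g * h)%g) (ptranslate k (mu g)) <=
  ((6 * C + 1)%:R / (L g).+1%:R)%:E)%E.
rewrite ptranslate_bind; apply: (@l1dist_bind_le R nat G _ _ (fun j => F j (k * g * h)%g)
  (fun j => ptranslate k (F j g)) (2 * (3 * C)%N%:R / (L g).+1%:R)
  ((L g).+1%:R^-1)).
- move=> j; rewrite /= mulf_eq0 negb_or invr_eq0 => /andP[_].
  rewrite /w; case: (boolP (_ <= _ < _)%N) => [/andP[Lj jL] _|]; last by rewrite eqxx.
  apply: (@le_trans _ _ (j.+1%:R^-1)%:E).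
    apply: Hbad; [by apply: Emono km; lia|by apply: Emono hn; lia|].
    apply/negP => gbad; pose i := (j.-1)./2.
    have : (L g <= i)%N.
      apply: Lbad; rewrite mem_cat.
      have [jE|jE] : (i.*2.+1 = j \/ i.*2.+2 = j)%N by rewrite /i; lia.
        by rewrite jE gbad.
      by rewrite jE gbad orbT.
    by rewrite /i; lia.
  by rewrite lee_fin lef_pV2 ?posrE// ler_nat.
- apply: l1dist_normalize; apply: le_trans (l1dist_interval _ _ _ _) _.
  by rewrite lee_fin ler_nat; lia.
- by rewrite invr_ge0.
- rewrite -[X in _ + X]mul1r -mulrDl ler_pM2r ?invr_gt0//.
  by rewrite -natrM natr1 ler_nat; lia.
Qed.

End Glue.

(** * The fibres of a wreath-like product *)

Section WreathCoordinates.
Variables (R : realType) (A B G : groupType) (I : choiceType).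
Variable act : left_action B I.
Local Notation N := (direct_sum I A).
Variables (iota : {multiplicative N -> G}) (eps : {multiplicative G -> B}).
Hypotheses (iota_inj : injective iota)
  (ker_eps : range iota = eps @^-1` [set 1%g]) (eps_surj : range eps = [set: B])
  (conj_factor : forall (g : G) (i : I),
     [set (g * x * g^-1)%g | x in iota @` dsum_factor A i]
     = iota @` dsum_factor A (act (eps g) i)).

(* The coordinate of [n] at [i], seen in [G] rather than in [A], so that it can be
   conjugated by elements of [G]. *)
Definition coord (i : I) (n : N) : G := iota (dsum_single i (val n i)).

Lemma coordM i n n' : coord i (n * n')%g = (coord i n * coord i n')%g.
Proof. by rewrite /coord -gmulfM -dsum_singleM. Qed.

Lemma dsum_single1 (i : I) : dsum_single i (1%g : A) = 1%g :> N.
Proof. by apply: dsum_ext => j; rewrite dsum_singleE; case: ifP. Qed.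

Lemma coord_eq1 i n : (coord i n == 1%g) = (val n i == 1%g).
Proof.
apply/eqP/eqP => [|ni]; last by rewrite /coord ni dsum_single1 multiplicative1.
rewrite -(multiplicative1 iota) => /iota_inj ni.
by rewrite -(val_dsum1 A i) -ni dsum_singleE eqxx.
Qed.

(** Distinct factors of the direct sum meet trivially. *)
Lemma coord_inj i j n n' : coord i n != 1%g -> coord i n = coord j n' -> i = j.
Proof.
rewrite coord_eq1 => ni /iota_inj nn; apply: contraNeq ni => ij.
have := congr1 (fun f : N => val f i) nn; rewrite !dsum_singleE eqxx => ->.
by rewrite (negbTE ij).
Qed.

Lemma coord_ext n n' : (forall i, coord i n = coord i n') -> n = n'.
Proof.
move=> nn; apply: dsum_ext => i; have /iota_inj := nn i.
by move=> /(congr1 (fun f : N => val f i)); rewrite !dsum_singleE eqxx.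
Qed.

Lemma coord_finite n : exists s : seq I, forall i, coord i n != 1%g -> i \in s.
Proof.
have /asboolP/finite_seqP[s sE] := valP n; exists s => i.
rewrite coord_eq1 => ni; have : [set i | val n i <> 1%g] i by exact/eqP.
by rewrite sE.
Qed.

Lemma dsum_ind (P : N -> Prop) : P 1%g -> (forall i a, P (dsum_single i a)) ->
  (forall n n', P n -> P n' -> P (n * n')%g) -> forall n, P n.
Proof.
move=> P1 Ps PM n; have [s] := coord_finite n.
elim: s n => [|i s IH] n ns.
  suff -> : n = 1%g by [].
  apply: dsum_ext => i; apply/eqP/negPn/negP => ni.
  by have := ns i; rewrite coord_eq1 => /(_ ni).
rewrite -(dsum_dropK i n); apply: PM => //; apply: IH => j.
rewrite coord_eq1 dsum_dropE; case: (j =P i) => [_|/eqP ji nj]; first by rewrite eqxx.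
by have := ns j; rewrite coord_eq1 inE (negbTE ji) => /(_ nj).
Qed.

(** Both sides are multiplicative in [n], so it suffices to treat elements of one factor, which
    conjugation by [k] carries into the factor indexed by its image under [eps k]. *)
Lemma coord_conj k n n' : iota n' = (k * iota n * k^-1)%g ->
  forall i, coord (act (eps k) i) n' = (k * coord i n * k^-1)%g.
Proof.
move: n n'; apply: dsum_ind => [|j a|n m IHn IHm] n'.
- rewrite multiplicative1 mulg1 mulgV -(multiplicative1 iota) => /iota_inj -> i.
  by rewrite /coord !val_dsum1 !dsum_single1 multiplicative1 mulg1 mulgV.
- move=> n'E i.
  have [f Ff fE] : (iota @` dsum_factor A (act (eps k) j)) (iota n').
    rewrite -conj_factor n'E; exists (iota (dsum_single j a)) => //.
    by exists (dsum_single j a) => // i' /eqP/negbTE i'j; rewrite dsum_singleE i'j.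
  move: fE => /iota_inj fE; rewrite -{n'}fE in n'E *.
  have [->|ij] := eqVneq i j.
    rewrite /coord (_ : dsum_single _ (val f _) = f); last first.
      apply: dsum_ext => i'; rewrite dsum_singleE; case: eqP => [->//|].
      by move=> /Ff ->.
    by rewrite n'E dsum_singleE eqxx.
  rewrite /coord dsum_singleE (negbTE ij) dsum_single1 multiplicative1 mulg1 mulgV.
  rewrite Ff ?dsum_single1 ?multiplicative1//.
  by move=> /(bij_inj (lact_bij act _)) /eqP; rewrite (negbTE ij).
- move=> n'E i.
  have conjP x : exists y, (k * iota x * k^-1)%g = iota y.
    apply: (ker_epsP ker_eps); rewrite !gmulfM (eps_iota ker_eps) mulg1 -gmulfM.
    by rewrite mulgV multiplicative1.
  have [[x xE] [y yE]] := (conjP n, conjP m).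
  have -> : n' = (x * y)%g.
    apply: iota_inj; rewrite n'E !gmulfM -xE -yE.
    by rewrite !mulgA mulgVK.
  rewrite !coordM (IHn _ (esym xE)) (IHm _ (esym yE)).
  by rewrite !mulgA mulgVK.
Qed.

Hypothesis cG : countable [set: G].

(** The level function shifted by one, with value 0 at the identity so that trivial coordinates
    weigh nothing. *)
Lemma coord_weight : exists l : G -> nat,
  [/\ l 1%g = 0%N,
      forall n, finite_set [set g | (l g <= n)%N] &
      forall k h, exists C, forall g,
        (l (k * g * h)%g <= l g + C)%N /\ (l g <= l (k * g * h)%g + C)%N].
Proof.
have [L [Lfin Ltr _]] := level_function cG (fun=> [::]).
exists (fun x => if x == 1%g then 0%N else (L x).+1); split.
- by rewrite eqxx.
- move=> n; apply: (@sub_finite_set _ _ ([set 1%g] `|` [set g | (L g <= n)%N])).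
    move=> g /=; case: eqP => [->|_ gn]; [by left|by right; exact: ltnW].
  by rewrite finite_setU; split.
move=> k h; have [[C HC] [C' HC']] := (Ltr k h, Ltr k^-1%g h^-1%g).
(* The last three terms serve the cases where just one of [g] and [k * g * h] is the identity. *)
exists (C + C' + L 1%g + L (k * 1%g * h)%g + 1)%N => g.
have := HC' (k * g * h)%g; rewrite !mulgA mulVg mul1g mulgK => Hg'.
have Hg := HC g.
split.
  case: eqP => // _; case: eqP => [->|_]; last by lia.
  by rewrite add0n addn1 ltnS leq_addl.
case: (g =P 1%g) => // _; case: eqP => [kgh|_]; last by lia.
rewrite kgh in Hg'; apply: leq_ltn_trans Hg' _.
rewrite add0n addn1 ltnS; apply: leq_trans (leq_addr _ _).
by rewrite addnAC leq_add2r leq_addl.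
Qed.


(** * The map on a fibre of the quotient *)

Section FibreMap.
Variables (s : B -> G) (l : G -> nat) (nu : G -> N).
Hypotheses (sP : forall b, eps (s b) = b)
  (nuP : forall g, iota (nu g) = (g * (s (eps g))^-1)%g)
  (l1 : l 1%g = 0%N)
  (lfin : forall n, finite_set [set g | (l g <= n)%N])
  (ltr : forall k h, exists C, forall g,
        (l (k * g * h)%g <= l g + C)%N /\ (l g <= l (k * g * h)%g + C)%N).

Definition fibre_weight (g : G) (i : I) : R := (l (coord i (nu g)))%:R.
Local Notation w := fibre_weight.
Definition fibre_mass (g : G) : R := fine (sumT (w g)).
Local Notation W := fibre_mass.

Lemma fibre_weight_ge0 g i : 0 <= w g i. Proof. exact: ler0n. Qed.

Lemma sumT_fibre_weight g : sumT (w g) = (W g)%:E.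
Proof.
have [J HJ] := coord_finite (nu g).
rewrite /W (@sumT_finite _ _ _ (undup J)) ?undup_uniq// => i.
rewrite mem_undup => iJ; rewrite /w.
by case: eqVneq (HJ i) => [-> _|_ /(_ isT) iJ']; [rewrite l1|rewrite iJ' in iJ].
Qed.

Lemma fibre_weight_le g i : w g i <= W g.
Proof. by rewrite -lee_fin -sumT_fibre_weight le_sumT1. Qed.

(* A nontrivial coordinate determines its index, so [g] is determined by the set
   of its coordinates, all of which have length at most [M]. *)
Lemma fibre_mass_finite b (M : nat) :
  finite_set [set g | eps g = b /\ W g <= M%:R].
Proof.
have /finite_seqP[S SE] := lfin M.
pose p (n : N) (y : G) : bool := `[< exists2 i, coord i n = y & y != 1%g >].
pose code (g : G) := [ffun y : seq_sub S => p (nu g) (val y)].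
have codeI g g' : eps g = b -> W g <= M%:R -> eps g' = b -> W g' <= M%:R ->
    code g = code g' -> g = g'.
  move=> gb gM gb' gM' cgg'.
  have lS h i : W h <= M%:R -> coord i (nu h) \in S.
    move=> hM; have : [set g | (l g <= M)%N] (coord i (nu h)).
      by rewrite /= -(ler_nat R); apply: le_trans hM; exact: fibre_weight_le.
    by rewrite SE.
  have sub h h' i : W h <= M%:R -> code h = code h' -> coord i (nu h) != 1%g ->
      coord i (nu h') = coord i (nu h).
    move=> hM chh' hi; have /ffunP/(_ (SeqSub (lS h i hM))) := chh'.
    rewrite !ffunE /= (_ : p (nu h) _ = true); last by apply/asboolP; exists i.
    move=> /esym/asboolP[j jE _].
    by rewrite [in LHS](coord_inj hi (esym jE)).
  have nuE : nu g = nu g'.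
    apply: coord_ext => i.
    have [gi|gi] := eqVneq (coord i (nu g)) 1%g; last exact/esym/sub.
    have [gi'|gi'] := eqVneq (coord i (nu g')) 1%g; first by rewrite gi gi'.
    exact: (sub g' g).
  have := nuP g'; rewrite -nuE nuP gb gb' => /(congr1 (fun x => x * s b)%g).
  by rewrite !mulgVK.
have [D DE] : {D : {ffun seq_sub S -> bool} -> G & forall g,
    eps g = b /\ W g <= M%:R -> D (code g) = g}.
  have [D HD] : {D : {ffun seq_sub S -> bool} -> G & forall c g,
      eps g = b /\ W g <= M%:R -> code g = c -> D c = g}.
    apply: (@choice _ _ (fun c x => forall g,
      eps g = b /\ W g <= M%:R -> code g = c -> x = g)) => c.
    have [[g [[gb gM] gc]]|ng] :=
        pselect (exists g, (eps g = b /\ W g <= M%:R) /\ code g = c).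
      by exists g => g' [gb' gM'] gc'; apply: codeI => //; rewrite gc gc'.
    by exists 1%g => g gP gc; exfalso; apply: ng; exists g.
  by exists D => g gP; exact: HD gP (erefl _).
apply: (@sub_finite_set _ _ (D @` [set: {ffun seq_sub S -> bool}])).
  by move=> g gP; exists (code g) => //; exact: DE.
by apply: finite_image; exact: finite_finset.
Qed.

(** As [S] omits the identity, each of its elements is the coordinate of [n] at no more than one
    index. *)
Lemma count_coord_le (n : N) (S : seq G) : uniq S -> 1%g \notin S ->
  (sumT (fun i => (coord i n \in S)%:R : R) <= (size S)%:R%:E)%E.
Proof.
move=> uS S1; apply: ge_sumT => J uJ; rewrite lee_fin -natr_sum ler_nat.
have -> : (\sum_(i <- J) (coord i n \in S) = size [seq i <- J | coord i n \in S])%N.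
  rewrite size_filter; elim: J {uJ} => [|i J IH]; first by rewrite big_nil.
  by rewrite big_cons IH.
rewrite -(size_map (fun i => coord i n)); apply: uniq_leq_size.
  rewrite map_inj_in_uniq ?filter_uniq// => i j.
  rewrite !mem_filter => /andP[iS _] _; apply: coord_inj.
  by apply: contraNneq S1 => <-.
by move=> _ /mapP[i + ->]; rewrite mem_filter => /andP[].
Qed.

(* Passing from [g] to [k g h] conjugates the coordinates by [k], up to a right
   multiplication at the finitely many indices [J].  The resulting error [C1] is
   absorbed by [eta * W g] except at the boundedly many coordinates of small
   length. *)
Lemma fibre_weight_translate b k h (eta : R) : 0 < eta ->
  exists2 C : R, 0 <= C & forall g, eps g = b ->
    (l1dist (fun i => w (k * g * h)%g (act (eps k) i)) (w g)
     <= (eta * W g + C)%:E)%E.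
Proof.
move=> eta0.
(* As long as [eps g = b], [nu (k * g * h)] is the conjugate of [nu g] by [k] times this [c], which
   does not depend on [g]. *)
have [c cE] : exists c : N,
    (k * s b * h * (s (eps (k * s b * h)))^-1)%g = iota c.
  apply: (ker_epsP ker_eps).
  by rewrite gmulfM multiplicativeV sP mulgV.
have [J HJ] : exists J : seq I, forall i,
    coord (act (eps k) i) c != 1%g -> i \in J.
  have [J HJ] := coord_finite c; exists (map (act (eps k)^-1%g) J) => i ci.
  by rewrite -(lactVK act (eps k) i); apply/map_f/HJ.
have [C1 HC1] := ltr k k^-1%g.
have [C2 HC2] : exists C2, forall i y, i \in J ->
    (l (k * y * k^-1 * coord (act (eps k) i) c)%g <= l y + C2)%N /\
    (l y <= l (k * y * k^-1 * coord (act (eps k) i) c)%g + C2)%N.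
  elim: J {HJ} => [|j J [C2 HC2]]; first by exists 0%N.
  have [C3 HC3] := ltr k (k^-1 * coord (act (eps k) j) c)%g.
  exists (C2 + C3)%N => i y; rewrite inE => /predU1P[->|/(HC2 i y)].
    have := HC3 y; rewrite !mulgA => -[H1 H2].
    by split; [apply: leq_trans H1 _|apply: leq_trans H2 _];
      rewrite leq_add2l leq_addl.
  by move=> [H1 H2]; split; [apply: leq_trans H1 _|apply: leq_trans H2 _];
    rewrite leq_add2l leq_addr.
(* Beyond length [M], the error [C1] is at most [eta] times the weight. *)
pose M := Num.bound (C1%:R / eta).
have MC1 m : (M < m)%N -> C1%:R <= eta * m%:R :> R.
  move=> Mm; rewrite mulrC -ler_pdivrMr//.
  apply: le_trans (ltW (archi_boundP _)) _; first by rewrite divr_ge0// ltW.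
  by rewrite ler_nat ltnW.
have /finite_seqP[S' SE'] := lfin M.
(* The identity is removed because it may be the coordinate at infinitely many indices; off [J] such
   indices have weight 0 before and after. *)
pose S := [seq y <- undup S' | y != 1%g].
have uS : uniq S by rewrite filter_uniq// undup_uniq.
have S1 : 1%g \notin S by rewrite mem_filter eqxx.
exists (C1%:R * (size S)%:R + C2%:R * (size (undup J))%:R) => [|g gb].
  by rewrite addr_ge0// mulr_ge0.
pose n' := (nu (k * g * h) * c^-1)%g.
have n'E : iota n' = (k * iota (nu g) * k^-1)%g.
  rewrite gmulfM multiplicativeV -cE !nuP gb !gmulfM sP gb.
  by rewrite !invgM !invgK !mulgA mulgVK mulgK.
have coordE i : coord (act (eps k) i) (nu (k * g * h)%g) =
    (k * coord i (nu g) * k^-1 * coord (act (eps k) i) c)%g.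
  by rewrite -(coord_conj n'E) -coordM mulgVK.
pose f i := eta * w g i + (C1%:R * (coord i (nu g) \in S)%:R + C2%:R * (i \in J)%:R).
apply: (@le_trans _ _ (sumT f)).
  apply: le_sumT => i; rewrite /f /w coordE.
  set y := coord i (nu g).
  have eta_y : 0 <= eta * (l y)%:R by rewrite mulr_ge0// ltW.
  have distn (a d C : nat) : (a <= d + C)%N -> (d <= a + C)%N ->
      `|a%:R - d%:R| <= C%:R :> R.
    by rewrite -!(ler_nat R) !natrD ler_norml => *; apply/andP; split; lra.
  case: (boolP (i \in J)) => iJ.
    have [H1 H2] := HC2 i y iJ; apply: le_trans (distn _ _ _ H1 H2) _.
    by rewrite mulr1 addrA lerDr addr_ge0// mulr_ge0.
  rewrite (_ : coord (act (eps k) i) c = 1%g) ?mulg1; last first.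
    by apply/eqP; apply: contraNT iJ => /HJ.
  rewrite mulr0 addr0.
  have [->|y1] := eqVneq y 1%g.
    by rewrite mulg1 mulgV l1 subrr normr0 (negbTE S1) !mulr0 addr0.
  have [H1 H2] := HC1 y; apply: le_trans (distn _ _ _ H1 H2) _.
  case: (leqP (l y) M) => yM.
    rewrite (_ : y \in S) ?mulr1 ?lerDr//.
    have yS' : [set` S'] y by rewrite -SE'.
    by rewrite mem_filter y1 mem_undup.
  by apply: le_trans (MC1 _ yM) _; rewrite lerDl mulr_ge0.
rewrite /f !sumTD; last 4 first.
- by move=> i; rewrite mulr_ge0.
- by move=> i; rewrite mulr_ge0.
- by move=> i; rewrite mulr_ge0 ?fibre_weight_ge0// ltW.
- by move=> i; rewrite addr_ge0// mulr_ge0.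
rewrite (sumTZ (ltW eta0) (fibre_weight_ge0 g)).
rewrite (@sumTZ R I C1%:R (fun i => (coord i (nu g) \in S)%:R))//.
rewrite (@sumTZ R I C2%:R (fun i => (i \in J)%:R))//.
rewrite sumT_fibre_weight !EFinD !EFinM leeD2l// leeD//.
  by apply: lee_wpmul2l; [rewrite lee_fin|exact: count_coord_le].
apply: lee_wpmul2l; first by rewrite lee_fin.
rewrite (@sumT_finite _ _ _ (undup J)) ?undup_uniq//.
  rewrite lee_fin -natr_sum ler_nat -sum1_size; apply: leq_sum => i _.
  by case: (i \in J).
by move=> i; rewrite mem_undup => /negbTE ->.
Qed.

Variable zeta : I -> Prob R G.

(** The point mass is a default for total weight 0, which over a given value of [eps g] occurs for
    finitely many [g] only. *)
Definition fibre_map (g : G) : Prob R G :=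
  match pselect (0 < W g) with
  | left W0 =>
      bind (normalize (fibre_weight_ge0 g) (sumT_fibre_weight g) W0) zeta
  | right _ => dirac_prob R 1%g
  end.

(** Once [W g] is large, the weights contribute [2 * (e / 4 + C / W g)], at most [e] since
    [4 * C <= e * W g], and [zeta] contributes another [e]. *)
Lemma fibre_map_translate b k h (e : R) : 0 < e ->
  (forall i, (l1dist (zeta (act (eps k) i)) (translate k (zeta i)) <= e%:E)%E) ->
  finite_set [set g | eps g = b /\
    ~ (l1dist (fibre_map (k * g * h)%g) (translate k (fibre_map g))
       <= (2 * e)%:E)%E].
Proof.
move=> e0 zk.
have eta0 : 0 < e / 4 by rewrite divr_gt0.
have [C C0 HC] := fibre_weight_translate b k h eta0.
pose M := Num.bound (4 * C / e).
pose b' := (eps k * b * eps h)%g.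
(* The [g] for which [k * g * h] falls into the default case. *)
pose Z := (fun x => k^-1 * x * h^-1)%g @` [set g | eps g = b' /\ W g <= 0%:R].
apply: (@sub_finite_set _ _ ([set g | eps g = b /\ W g <= M%:R] `|` Z)); last first.
  by rewrite finite_setU; split; [exact: fibre_mass_finite|
    apply: finite_image; exact: fibre_mass_finite].
move=> g [gb ng]; apply: contrapT => /not_orP[gM gZ]; apply: ng.
have {}gM : M%:R < W g by rewrite ltNge; apply/negP => gM'; apply: gM.
have W0 : 0 < W g by apply: le_lt_trans gM.
have W'0 : 0 < W (k * g * h)%g.
  rewrite ltNge; apply/negP => W'; apply: gZ; exists (k * g * h)%g.
    by rewrite /= !gmulfM gb.
  by rewrite !mulgA mulVg mul1g mulgK.
rewrite /fibre_map; case: pselect => // W'0'; case: pselect => // W0'.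
apply: (@l1dist_bind_translate_le _ _ _ (act (eps k)) _ _ _ _
  (2 * (e / 4 * W g + C) / W g) e).
- exact: lact_bij.
- by move=> i _; exact: zk.
- have w'0 i : 0 <= w (k * g * h)%g (act (eps k) i) by exact: fibre_weight_ge0.
  have w'W : sumT (fun i => w (k * g * h)%g (act (eps k) i)) = (W (k * g * h)%g)%:E.
    by rewrite -(reindex_sumT _ (lact_bij act (eps k))) sumT_fibre_weight.
  exact: (l1dist_normalize w'0 w'W W'0' (fibre_weight_ge0 g)
    (sumT_fibre_weight g) W0' (HC g gb)).
- exact: ltW.
have CW : 4 * C <= e * W g.
  rewrite [leRHS]mulrC -ler_pdivrMr//.
  apply: le_trans (ltW (archi_boundP _)) (ltW gM).
  by rewrite divr_ge0 ?mulr_ge0// ltW.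
rewrite mulrDr mulrDl -lerBrDr.
have -> : 2 * (e / 4 * W g) / W g = e / 2 by field; rewrite gt_eqF.
suff : 2 * C / W g <= e / 2 by lra.
by rewrite ler_pdivrMr//; lra.
Qed.

End FibreMap.
End WreathCoordinates.

Lemma uniform_bound (T : eqType) (K : seq T) (P : T -> nat -> Prop) :
  (forall t m n, (m <= n)%N -> P t m -> P t n) -> (forall t, exists n, P t n) ->
  exists n, forall t, t \in K -> P t n.
Proof.
move=> Pmono Pex; elim: K => [|t K [n IH]]; first by exists 0%N.
have [m tm] := Pex t; exists (m + n)%N => u; rewrite inE => /predU1P[->|uK].
  exact: Pmono (leq_addr _ _) tm.
exact: Pmono (leq_addl _ _) (IH _ uK).
Qed.

(** * Interpolation between the two maps *)

Section Main.
Variables (R : realType) (A B G : groupType) (I : choiceType).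
Variable act : left_action B I.
Hypotheses (cB : countable [set: B]) (cG : countable [set: G]).

Lemma wreath_like_bi_exact : wreath_like A act G ->
  amenable R A -> bi_exact R B -> amenable_stabilizers R act -> bi_exact R G.
Proof.
move=> [iota [eps [iota_inj ker_eps eps_surj conjA]]] amA [exB [muB HmuB]] amI.
have rN : reiter R (direct_sum I A) by exact/reiter_dsum/amenable_reiter.
split; first exact: exact_group_extension ker_eps eps_surj cG exB rN.
apply: bi_exact_glue => // K e e0.
have [X [actX [[x0 _] cX _ _ HX]]] := exact_group_lift ker_eps eps_surj exB rN.
have e40 : 0 < e / 4 by rewrite divr_gt0.
have [mu [cmu mu_tr]] := HX K _ e40.
have [zeta zetaP] := amenable_stabilizer_lift x0
  (fun d => tight_family cX cmu) amI mu_tr.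
pose zetaB b := mu (actX b x0).
have zetaBP k b : k \in K ->
    (l1dist (zetaB (eps k * b)%g) (translate k (zetaB b)) <= (e / 4)%:E)%E.
  by move=> kK; rewrite /zetaB lactM; exact: mu_tr.
pose F1 g := bind (muB (eps g)) zetaB.
have [s sP] := eps_section eps_surj.
have [l [l1 lfin ltr]] := coord_weight cG.
have [nu nuP] : {nu : G -> direct_sum I A & forall g,
    iota (nu g) = (g * (s (eps g))^-1)%g}.
  apply: (@choice _ _ (fun g n => iota n = (g * (s (eps g))^-1)%g)) => g.
  have [|n nE] := ker_epsP ker_eps (g := (g * (s (eps g))^-1)%g).
    by rewrite gmulfM multiplicativeV sP mulgV.
  by exists n.
pose F2 := fibre_map iota_inj nu l1 zeta.
pose KK := [seq (k, h) | k <- K, h <- K].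
have [S0 HS0] : exists S0 : seq B, forall k h b, k \in K -> h \in K -> b \notin S0 ->
    (l1dist (muB (eps k * b * eps h)%g) (translate (eps k) (muB b)) <= (e / 4)%:E)%E.
  have [|S0 HS0] := @finite_family_seq _ _ KK (fun kh => [set b |
     ~ (l1dist (muB (eps kh.1 * b * eps kh.2)%g) (translate (eps kh.1) (muB b))
        <= (e / 4)%:E)%E]).
    move=> kh _; have := (ge0_cvge0P (frechet_Filter B)
      (fun b => l1dist_ge0 _ _)).1 (HmuB (eps kh.2) (eps kh.1)) _ e40.
    by [].
  exists S0 => k h b kK hK; apply: contraNP => nb.
  by apply: (HS0 (k, h)) => //; exact: allpairs_f.
have [LB [LBfin LBtr LBS0]] := level_function cB (fun=> S0).
have [C HC] : exists C, forall kh, kh \in KK -> forall b,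
    (LB (eps kh.1 * b * eps kh.2)%g <= LB b + C)%N /\
    (LB b <= LB (eps kh.1 * b * eps kh.2)%g + C)%N.
  apply: uniform_bound => [kh m n mn H b|[k h]] /=.
    by have [H1 H2] := H b; split; [apply: leq_trans H1 _|apply: leq_trans H2 _];
      rewrite leq_add2l.
  have [C1 HC1] := LBtr (eps k) (eps h).
  have [C2 HC2] := LBtr (eps k)^-1%g (eps h)^-1%g.
  exists (C1 + C2)%N => b; split.
    by apply: leq_trans (HC1 b) _; rewrite leq_add2l leq_addr.
  have := HC2 (eps k * b * eps h)%g; rewrite !mulgA mulVg mul1g mulgK => H.
  by apply: leq_trans H _; rewrite leq_add2l leq_addl.
(* Each end of the averaging window, of length [M.+1], moves by at most [C]; normalizing doubles the
   total [2 * C]. *)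
have [M eM] := natr_div_le (ler0n R (4 * C)) (divr_gt0 e0 (ltr0n R 2)).
have {}eM := eM M (leqnn M).
(* The share of [F2] in [F g] is 1 when [eps g \in S0], 0 off a finite set of
   values of [eps g], and varies slowly in between. *)
pose v b (j : nat) : R := ((LB b <= j < LB b + M.+1)%N)%:R.
have v0 b j : 0 <= v b j by [].
have vM b : sumT (v b) = (M.+1%:R)%:E by rewrite sumT_interval addKn.
have M0 : 0 < M.+1%:R :> R by [].
pose F g := bind (normalize (v0 (eps g)) (vM (eps g)) M0)
  (fun j => if (j <= M)%N then F2 g else F1 g).
exists F => k h kK hK.
(* [F2] enters [F g] only if [LB (eps g) <= M], hence over finitely many values of [eps g], each
   with finitely many exceptions. *)
have [S2 HS2] : exists S2 : seq G, forall g, (LB (eps g) <= M)%N -> g \notin S2 ->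
    (l1dist (F2 (k * g * h)%g) (translate k (F2 g)) <= (2 * (e / 4))%:E)%E.
  have /finite_seqP[SB SBE] := LBfin M.
  have [|S2 HS2] := @finite_family_seq _ _ SB (fun b => [set g | eps g = b /\
    ~ (l1dist (F2 (k * g * h)%g) (translate k (F2 g)) <= (2 * (e / 4))%:E)%E]).
    by move=> b _; apply: fibre_map_translate => // i; exact: zetaP.
  exists S2 => g gM; apply: contraNP => ng; apply: (HS2 (eps g)) => //.
  have : [set b | (LB b <= M)%N] (eps g) by [].
  by rewrite SBE.
apply: (@sub_finite_set _ _ [set` S2]); last exact: finite_seq.
move=> g ng; apply/negPn/negP => gS2; apply: ng.
change (l1dist (F (k * g * h)%g) (ptranslate k (F g)) <= e%:E)%E.
rewrite ptranslate_bind; apply: (@l1dist_bind_le R nat G _ _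
  (fun j => if (j <= M)%N then F2 (k * g * h)%g else F1 (k * g * h)%g) _
  (2 * (2 * C)%N%:R / M.+1%:R) (e / 2)).
- move=> j; rewrite /= mulf_eq0 negb_or invr_eq0 => /andP[_].
  rewrite /v; case: (boolP (_ <= _ < _)%N) => [/andP[Lj jL] _|]; last by rewrite eqxx.
  case: ifP => [jM|/negbT]; last rewrite -ltnNge => Mj.
    rewrite (_ : e / 2 = 2 * (e / 4)); last by lra.
    by apply: HS2 => //; exact: leq_trans jM.
  apply: (@l1dist_bind_translate_le _ _ _ (fun b => eps k * b)%g _ _ _ _ (e / 4) (e / 4)).
  + exact: mulgI_bij.
  + by move=> b _; exact: zetaBP.
  + rewrite l1dist_shift !gmulfM; apply: HS0 => //.
    by apply/negP => /(LBS0 0%N); lia.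
  + exact: ltW.
  + by lra.
- apply: l1dist_normalize; apply: le_trans (l1dist_interval R
    (LB (eps (k * g * h)%g)) (LB (eps (k * g * h)%g) + M.+1) (LB (eps g)) _) _.
  have [] := HC (k, h) (allpairs_f _ kK hK) (eps g).
  rewrite /= !gmulfM lee_fin ler_nat.
  set a := LB (_ * _ * _)%g; set b := LB _; lia.
- by rewrite divr_ge0// ltW.
- rewrite -natrM mulnA -lerBrDr (_ : e - e / 2 = e / 2); last by lra.
  exact: eM.
Qed.

End Main.

Theorem theorem1 (R : realType) (A B G : groupType) (I : Type)
    (act : left_action B I) :
  countable [set: A] -> countable [set: B] -> countable [set: G] ->
  wreath_like A act G ->
  amenable R A -> bi_exact R B -> amenable_stabilizers R act ->
  bi_exact R G.
Proof.
(* [I] is a mere type; [{classic I}] makes it a [choiceType]. *)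
move=> _ cB cG.
exact: (@wreath_like_bi_exact R A B G {classic I} act cB cG).
Qed.
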